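(* Let $M\in\mathbb{R}$, let $f\in BV(X)$ be such that $f\le M$ a.e. on $X$, let $\Omega\subset X$ be a domain such that $\mu(X\setminus\Omega)>0$, and let $u\in BV(X)$ be a solution to the Dirichlet problem for least gradients in $\Omega$ with boundary data $f$. Then $u\le M$ a.e. in $\Omega$.
   Context: Standing assumptions: $(X,d,\mu)$ is a complete metric space with a Borel regular outer measure $\mu$ that is doubling: there is $c_d>0$ with $0<\mu(B(x,2r))\le c_d\,\mu(B(x,r))<\infty$ for every ball $B(x,r)=\{y\in X: d(y,x)<r\}$ (in particular $X$ is proper). $X$ supports a $(1,1)$-Poincaré inequality: there are $c_P>0$, $\lambda\ge 1$ such that for every ball $B(x,r)$, every locally integrable function $u$ and every upper gradient $g$ of $u$, $\frac{1}{\mu(B(x,r))}\int_{B(x,r)}|u-u_{B(x,r)}|\,d\mu\le c_P\, r\,\frac{1}{\mu(B(x,\lambda r))}\int_{B(x,\lambda r)}g\,d\mu$, where $u_{B}=\frac1{\mu(B)}\int_B u\,d\mu$. Upper gradients: a nonnegative Borel function $g$ is an upper gradient of an extended real-valued function $u$ if for every rectifiable curve $\gamma$ (defined on a compact interval) with end points $x,y$, $|u(x)-u(y)|\le\int_\gamma g\,ds$ when $u(x),u(y)$ are both finite, and $\int_\gamma g\,ds=\infty$ otherwise. $N^{1,1}(X)$ is the space of functions with $\|u\|_{L^1(X)}+\inf_g\|g\|_{L^1(X)}<\infty$ (infimum over upper gradients $g$ of $u$); $N^{1,1}(\Omega)$ is defined similarly for open $\Omega\subset X$. $\Omega'\Subset\Omega$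 means $\Omega'$ is open and $\overline{\Omega'}$ is a compact subset of $\Omega$; the subscript ''loc'' means the property holds on every $\Omega'\Subset\Omega$. Total variation: for open $\Omega\subset X$ and $u\in L^1_{\mathrm{loc}}(\Omega)$, $\|Du\|(\Omega)=\inf\{\liminf_{i\to\infty}\int_\Omega g_{u_i}\,d\mu:\ u_i\in N^{1,1}_{\mathrm{loc}}(\Omega),\ u_i\to u\text{ in }L^1_{\mathrm{loc}}(\Omega)\}$, where $g_{u_i}$ is an upper gradient of $u_i$ in $\Omega$. For an arbitrary set $A$, $\|Du\|(A)$ is the infimum of $\|Du\|(U)$ over open sets $U\supset A$ (contained in the domain of $u$). $u\in BV(\Omega)$ means $u\in L^1(\Omega)$ and $\|Du\|(\Omega)<\infty$. A domain is a connected open set. $BV_0(\Omega)$ is the set of $g\in BV(X)$ with $g=0$ $\mu$-a.e. in $X\setminus\Omega$. Given an open set $\Omega\subset X$ and $f\in BV(X)$, a function $u\in BV(X)$ is a solution to the Dirichlet problem for least gradients in $\Omega$ with boundary data $f$ if $u-f\in BV_0(\Omega)$ and $\|Du\|(\overline\Omega)\le\|D(u+g)\|(\overline\Omega)$ for every $g\in BV_0(\Omega)$. *)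

(* Defs.v *)
From HB Require Import structures.
From mathcomp Require Import all_boot all_order all_algebra.
From mathcomp Require Import all_classical all_reals all_analysis measurable_realfun.

Set Implicit Arguments.
Unset Strict Implicit.
Unset Printing Implicit Defensive.

Import Order.TTheory GRing.Theory Num.Theory.
Import numFieldNormedType.Exports.

Local Open Scope classical_set_scope.
Local Open Scope ring_scope.

(** The measurable types of MathComp-Analysis are pointed, hence the base
    point; the spaces considered here have positive measure, so they are
    nonempty anyway. *)
#[short(type="completeMetricType")]
HB.structure Definition CompleteMetric (R : realType) :=
  { T of Pointed T & Metric R T & Complete T }.

Section curves.
Context {R : realType} {X : completeMetricType R}.
Implicit Types (a b : R) (c : R -> X) (Omega : set X) (u g : X -> \bar R).
Local Open Scope ereal_scope.

(** A curve is a map [c : R -> X] of which only the restriction to [`[a, b]]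
    matters. *)
Definition curve_length a b c : \bar R :=
  ereal_sup [set (let p := c \o nth b (a :: s) in
                  \sum_(0 <= n < size s) mdist (p n) (p n.+1))%R%:E
            | s in itv_partition a b].

Definition rectifiable_curve a b c :=
  [/\ (a <= b)%R, {within `[a, b], continuous c} & curve_length a b c < +oo].

(** [c] reparametrized by arc length: its value at [s] is [c t] for the first
    time [t] at which the length of [c] on [`[a, t]] reaches [s]. *)
Definition arclength_param a b c (s : R) : X :=
  c (inf [set t | t \in `[a, b] /\ s%:E <= curve_length a t c]).

Definition path_integral a b c g : \bar R :=
  \int[lebesgue_measure]_(s in `[0%R, fine (curve_length a b c)])
     g (arclength_param a b c s).

Definition borel_fun Omega g :=
  @measurable_fun _ _ (g_sigma_algebraType (@open X)) _ Omega g.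

(** Constant curves are allowed, so a function with an upper gradient in
    [Omega] is finite at every point of [Omega]. *)
Definition upper_gradient Omega u g :=
  [/\ borel_fun Omega g,
      forall x, Omega x -> 0 <= g x &
      forall a b c, rectifiable_curve a b c -> c @` `[a, b] `<=` Omega ->
        if (u (c a) \is a fin_num) && (u (c b) \is a fin_num)
        as _ return Prop then `|u (c a) - u (c b)| <= path_integral a b c g
        else path_integral a b c g = +oo].

Definition compactly_inside (Omega' Omega : set X) :=
  [/\ open Omega', compact (closure Omega') & closure Omega' `<=` Omega].

Definition domain Omega := open Omega /\ connected Omega.

End curves.

Section measure.
Context {R : realType} {X : completeMetricType R}.
Variable mu : {outer_measure set X -> \bar R}.
Implicit Types (A B Omega U : set X) (u v f g : X -> \bar R).
Local Open Scope ereal_scope.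

(** The measure induced by [mu] on its Caratheodory-measurable sets, with
    respect to which all integrals over subsets of [X] are taken. *)
Definition cara_measure : {measure set (caratheodory_type mu) -> \bar R} :=
  (mu : set (caratheodory_type mu) -> \bar R).

Definition borel_regular :=
  (forall B, <<s @open X >> B -> mu.-caratheodory B) /\
  (forall A, exists B, [/\ <<s @open X >> B, A `<=` B & mu B = mu A]).

Definition doubling :=
  exists2 cd : R, (0 < cd)%R & forall (x : X) (r : R), (0 < r)%R ->
    [/\ 0 < mu (ball x (2 * r)%R),
        mu (ball x (2 * r)%R) <= cd%:E * mu (ball x r) &
        cd%:E * mu (ball x r) < +oo].

Definition L1 Omega u := cara_measure.-integrable Omega u.

Definition L1loc Omega u :=
  forall Omega', compactly_inside Omega' Omega -> L1 Omega' u.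

Definition cvg_L1loc Omega (v : nat -> X -> \bar R) u :=
  forall Omega', compactly_inside Omega' Omega ->
    \int[cara_measure]_(x in Omega') `|v i x - u x| @[i --> \oo] --> 0.

Definition average B u : \bar R :=
  (fine (mu B))^-1%:E * \int[cara_measure]_(x in B) u x.

Definition poincare11 :=
  exists cP lambda : R, [/\ (0 < cP)%R, (1 <= lambda)%R &
    forall (x : X) (r : R) u g, (0 < r)%R ->
      L1loc setT u -> upper_gradient setT u g ->
      average (ball x r) (fun y => `|u y - average (ball x r) u|) <=
        (cP * r)%:E * average (ball x (lambda * r)%R) g].

Definition N11 Omega u :=
  @measurable_fun _ _ (caratheodory_type mu) _ Omega u /\
  \int[cara_measure]_(x in Omega) `|u x| +
    ereal_inf [set \int[cara_measure]_(x in Omega) g x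
              | g in upper_gradient Omega u] < +oo.

Definition N11loc Omega u :=
  forall Omega', compactly_inside Omega' Omega -> N11 Omega' u.

(** The total variation of [u] on an open set [Omega], for
    [u] in [L1loc Omega]. *)
Definition total_variation_open Omega u : \bar R :=
  ereal_inf [set l | exists v g : nat -> X -> \bar R,
    [/\ forall i, N11loc Omega (v i),
        forall i, upper_gradient Omega (v i) (g i),
        cvg_L1loc Omega v u &
        l = limn_einf (fun i => \int[cara_measure]_(x in Omega) g i x)]].

Definition total_variation_set A u : \bar R :=
  ereal_inf [set total_variation_open U u | U in [set U | open U /\ A `<=` U]].

Definition BV Omega u := L1 Omega u /\ total_variation_open Omega u < +oo.

Definition BV0 Omega g :=
  BV setT g /\ {ae cara_measure, forall x, (~` Omega) x -> g x = 0}.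

Definition least_gradient_solution Omega f u :=
  [/\ BV setT u,
      BV0 Omega (fun x => u x - f x) &
      forall g, BV0 Omega g ->
        total_variation_set (closure Omega) u <=
          total_variation_set (closure Omega) (fun x => u x + g x)].

End measure.

(* Main.v *)
Require Import Defs.
From mathcomp Require Import all_boot all_order all_algebra.
From mathcomp Require Import all_classical all_reals all_analysis measurable_realfun.
From mathcomp Require Import ring lra.

(** Put [g = - max (u - M, 0)], so that [u + g = min (u, M)].  As [f <= M] and
    [u = f] outside [Omega], [g] vanishes almost everywhere outside [Omega] and
    [|g| <= |u - f|]; thus [g] is an admissible variation.

    The total variation splits under truncation ([total_variation_truncation]):
    [|D min(u, M)|(U) + |Dg|(U) <= |Du|(U)] for every open [U].  The reason is the
    locality of upper gradients ([upper_gradient_max]): along a curve, the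
    variation of [max (v, m)] is spent where [v > m] only.  Indeed a function
    which starts above [m] equals [m] when it first leaves the set [{v > m}], and
    the piece of the curve up to that time already pays for the drop
    ([excess_le_integral]).  To speak of pieces of curves one parametrizes by arc
    length; all that is used later is recorded in [unit_arc].

    Minimality of [u] against [u + g] now leaves [|Dg|(closure Omega) = 0], and it
    remains to see that a function [g <= 0] vanishing outside [Omega] and without
    variation on [closure Omega] is zero ([total_variation_eq0_ge0]).  This follows
    from the Poincaré inequality on balls a part of which lies outside [Omega]
    ([poincare_vanishing_on]), but this inequality wants functions and upper
    gradients on the whole space, whereas the smallness of [|Dg|] is only
    available on open neighbourhoods [U] of [closure Omega].  Hence the
    approximants [k] of [g] on [U] are replaced by
    [max (min (- k, 1) - theta - D, 0)], where [D] is a Lipschitz function which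
    vanishes on [closure Omega] (within a large ball) and is at least 1 outside a
    relatively compact subset of [U]; this extends by zero
    ([upper_gradient_zero_extension]).  By locality once more, the slope of [D] is
    only paid for at points outside [closure Omega] where [- k > theta].  These
    have small measure because [k] is close in [L^1] to [g], which is zero there
    ([bump_upper_gradient], [bump_integral_le0]).  The space being complete and
    doubling, its closed balls are compact ([doubling_proper]), which provides
    [D] and makes local convergence in [L^1] effective on balls. *)

Set Implicit Arguments.
Unset Strict Implicit.
Unset Printing Implicit Defensive.

Import Order.TTheory GRing.Theory Num.Theory.
Import numFieldNormedType.Exports.

Local Open Scope classical_set_scope.
Local Open Scope ring_scope.

(** * Length of curves *)

Section curve_length.
Context {R : realType} {X : completeMetricType R} (c : R -> X).
Implicit Types (a b m t x : R) (s : seq R).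

Fixpoint polygon_length x s : R :=
  if s is y :: s' then mdist (c x) (c y) + polygon_length y s' else 0.

Lemma polygon_length_cat x s1 s2 :
  polygon_length x (s1 ++ s2) =
  polygon_length x s1 + polygon_length (last x s1) s2.
Proof. by elim: s1 x => [|y s IH] x /=; rewrite ?add0r// IH addrA. Qed.

Lemma curve_lengthE a b : curve_length a b c =
  ereal_sup [set (polygon_length a s)%:E | s in itv_partition a b].
Proof.
rewrite /curve_length; congr ereal_sup; apply/eq_imagel => s _ /=; congr EFin.
elim: s a => [|y s IH] a /=; first by rewrite big_nil.
by rewrite big_nat_recl //= -(IH y).
Qed.

Lemma polygon_length_le a b s : itv_partition a b s ->
  ((polygon_length a s)%:E <= curve_length a b c)%E.
Proof. by move=> abs; rewrite curve_lengthE; apply: ereal_sup_ubound; exists s. Qed.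

Lemma mdist_le_curve_length a b : a <= b ->
  ((mdist (c a) (c b))%:E <= curve_length a b c)%E.
Proof.
rewrite le_eqVlt => /predU1P[<-|ab].
  by rewrite mdistxx; have := @polygon_length_le a a [::]; apply; split => /=.
have := @polygon_length_le a b [:: b]; rewrite /= addr0; apply.
exact: itv_partition1.
Qed.

Lemma curve_length_ge0 a b : a <= b -> (0 <= curve_length a b c)%E.
Proof.
by move=> ab; apply: le_trans (mdist_le_curve_length ab); rewrite lee_fin mdist_ge0.
Qed.

Lemma curve_lengthxx a : curve_length a a c = 0%E.
Proof.
apply/eqP; rewrite eq_le curve_length_ge0// andbT curve_lengthE.
by apply: ge_ereal_sup => _ [s /itv_partitionxx -> <-].
Qed.

Lemma curve_length_cat a m b : a <= m -> m <= b ->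
  (curve_length a m c + curve_length m b c <= curve_length a b c)%E.
Proof.
move=> am mb; set y := curve_length a b c.
have part s : itv_partition a m s ->
    ((polygon_length a s)%:E + curve_length m b c <= y)%E.
  move=> ams; rewrite addeC -leeBrDr// curve_lengthE.
  apply: ge_ereal_sup => _ [t mbt <-]; rewrite leeBrDr// -EFinD addrC.
  have -> : m = last a s by case: ams => _ /eqP.
  rewrite -polygon_length_cat; apply: polygon_length_le.
  exact: itv_partition_cat mbt.
have [s ams] : itv_partition a m !=set0.
  move: am; rewrite le_eqVlt => /predU1P[<-|am]; first by exists [::]; split => /=.
  by exists [:: m]; exact: itv_partition1.
have [mbfin|] := boolP (curve_length m b c \is a fin_num).
  rewrite -leeBrDr// curve_lengthE.
  by apply: ge_ereal_sup => _ [t amt <-]; rewrite leeBrDr//; exact: part.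
rewrite ge0_fin_numE ?curve_length_ge0// ltey negbK => /eqP mboo.
by have := part s ams; rewrite mboo addey// leye_eq => /eqP ->; rewrite leey.
Qed.

Lemma le_curve_length_cat a m b : a <= m -> m <= b ->
  (curve_length a b c <= curve_length a m c + curve_length m b c)%E.
Proof.
move=> am mb; rewrite {1}curve_lengthE; apply: ge_ereal_sup => _ [s abs <-].
elim: s a am abs => [|h s IH] a am abs /=.
  by rewrite adde_ge0// curve_length_ge0.
have hbs : itv_partition h b s by exact: itv_partition_cons abs.
have ah : a < h by case: abs => /= /andP[].
have [hm|mh] := leP h m.
  rewrite EFinD; apply: (@le_trans _ _
    ((mdist (c a) (c h))%:E + (curve_length h m c + curve_length m b c))%E).
    by rewrite leeD2l// IH.
  rewrite addeA leeD2r//; apply: le_trans (curve_length_cat (ltW ah) hm).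
  by rewrite leeD2r// mdist_le_curve_length// ltW.
apply: (@le_trans _ _ ((mdist (c a) (c m))%:E + (polygon_length m (h :: s))%:E)%E).
  by rewrite -EFinD lee_fin /= addrA lerD2r metric_triangle.
apply: leeD; first exact: mdist_le_curve_length.
by apply: polygon_length_le; case: abs => /= /andP[_ hs] sb; split => //=; rewrite mh.
Qed.

Lemma curve_lengthD a m b : a <= m -> m <= b ->
  curve_length a b c = (curve_length a m c + curve_length m b c)%E.
Proof.
by move=> am mb; apply/eqP; rewrite eq_le le_curve_length_cat// curve_length_cat.
Qed.

(** Insert into a nearly optimal partition a point [t] close to [a]: the first
    chord changes by at most [mdist (c a) (c t)], so that [t] cuts off little
    length. *)
Lemma curve_length_right a b e : a < b -> (0 < e) ->
  (curve_length a b c < +oo)%E ->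
  (forall e, 0 < e -> exists2 d, 0 < d &
     forall t, a <= t <= b -> t < a + d -> mdist (c a) (c t) < e) ->
  exists2 d, 0 < d &
     forall t, a <= t <= b -> t < a + d -> (curve_length a t c <= e%:E)%E.
Proof.
move=> ab e0 Lfin cc.
have Lf : curve_length a b c \is a fin_num.
  by rewrite ge0_fin_numE// curve_length_ge0// ltW.
have e20 : 0 < e / 2 by rewrite divr_gt0.
have := Lf; rewrite curve_lengthE => /(ub_ereal_sup_adherent e20).
rewrite -curve_lengthE => -[_ [s abs <-]].
have [d d0 dP] := cc _ e20.
case: s abs => [[_ /= /eqP ab'] |h s abs]; first by rewrite ab' ltxx in ab.
have ah : a < h by case: abs => /= /andP[].
move=> Ls; exists (Num.min d (h - a)); first by rewrite lt_min d0 subr_gt0.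
move=> t /andP[a_t tb]; rewrite -ltrBlDl lt_min => /andP[td th].
have {}th : t < h by lra.
have {dP}ct : mdist (c a) (c t) < e / 2 by apply: dP; rewrite ?a_t//; lra.
have hb : h <= b by apply: itv_partition_le; exact: itv_partition_cons abs.
have ths : itv_partition t b (h :: s).
  by case: abs => /= /andP[_ hs] sb; split => //=; rewrite th.
have := polygon_length_le ths; rewrite /= => Lt.
move: Ls Lt Lf; rewrite (curve_lengthD a_t tb) fin_numD => Ls Lt /andP[].
move=> /fineK af /fineK tf; move: Ls Lt; rewrite -af -tf -!EFinD lte_fin !lee_fin /=.
move: (metric_triangle (c a) (c t) (c h)); lra.
Qed.

(** Same argument as for [curve_length_right], at the last chord. *)
Lemma curve_length_left a b e : a < b -> (0 < e) ->
  (curve_length a b c < +oo)%E ->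
  (forall e, 0 < e -> exists2 d, 0 < d &
     forall t, a <= t <= b -> b - d < t -> mdist (c b) (c t) < e) ->
  exists2 d, 0 < d &
     forall t, a <= t <= b -> b - d < t -> (curve_length t b c <= e%:E)%E.
Proof.
move=> ab e0 Lfin cc.
have Lf : curve_length a b c \is a fin_num.
  by rewrite ge0_fin_numE// curve_length_ge0// ltW.
have e20 : 0 < e / 2 by rewrite divr_gt0.
have := Lf; rewrite curve_lengthE => /(ub_ereal_sup_adherent e20).
rewrite -curve_lengthE => -[_ [s abs <-]].
have [d d0 dP] := cc _ e20.
case/lastP: s abs => [[_ /= /eqP ab'] |s b' abs]; first by rewrite ab' ltxx in ab.
have b'b : b' = b by case: abs => _; rewrite last_rcons => /eqP.
subst b'; set h := last a s.
have [ahs hb] : itv_partition a h s /\ h < b.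
  by case: abs; rewrite rcons_path => /andP[? ?] _.
move=> Ls; exists (Num.min d (b - h)); first by rewrite lt_min d0 subr_gt0.
move=> t /andP[a_t tb]; rewrite ltrBlDr -ltrBlDl lt_min => /andP[td th].
have {}th : h < t by lra.
have {dP}ct : mdist (c b) (c t) < e / 2 by apply: dP; rewrite ?a_t//; lra.
have ths : itv_partition a t (rcons s t).
  by case: ahs => ? _; split => /=; rewrite ?last_rcons// rcons_path th andbT.
have := polygon_length_le ths; move: Ls.
rewrite -!cats1 !polygon_length_cat /= !addr0 -/h => Ls Lt.
move: Ls Lt Lf; rewrite (curve_lengthD a_t tb) fin_numD => Ls Lt /andP[].
move=> /fineK af /fineK tf; move: Ls Lt; rewrite -af -tf -!EFinD lte_fin !lee_fin /=.
move: (metric_triangle (c h) (c t) (c b)); rewrite (metric_sym (c t)); lra.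
Qed.

End curve_length.

(** * Arc length parametrization *)

Lemma ge0_integral_translation (R : realType) (h : R -> \bar R) (s t : R) :
  measurable_fun `[s, t] h -> (forall x, x \in `[s, t] -> 0 <= h x)%E ->
  (\int[lebesgue_measure]_(x in `[0%R, (t - s)%R]) h (s + x)%R =
   \int[lebesgue_measure]_(x in `[s, t]) h x)%E.
Proof.
move=> mh h0.
have mphi : measurable_fun [set: measurableTypeR R]
    ((fun x => s + x) : _ -> measurableTypeR R) by exact: measurable_funD.
rewrite (_ : `[0%R, (t - s)%R]%classic =
    ((fun x => s + x) : _ -> measurableTypeR R) @^-1` `[s, t]); last first.
  apply/seteqP; split => x /=; rewrite !in_itv /= => /andP[? ?]; apply/andP; split; lra.
rewrite -[LHS](ge0_integral_pushforward mphi _ _ mh) //; last first.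
  by move=> y; rewrite inE /= => /h0.
apply: eq_measure_integral => A mA AS.
apply/esym; apply: (@lebesgue_measure_unique R (pushforward lebesgue_measure _)) => //=.
move=> _ [[a b]] _ <-.
rewrite /pushforward /= (_ : _ @^-1` _ = `](a - s)%R, (b - s)%R]%classic); last first.
  apply/seteqP; split => x /=; rewrite !in_itv /= => /andP[? ?]; apply/andP; split; lra.
by rewrite !lebesgue_measure_itv /= !lte_fin ltrD2r -!EFinD; case: ifP => // _; congr EFin; lra.
Qed.

Lemma lipschitz1_continuous (R : realType) (X : completeMetricType R) (γ : R -> X) :
  (forall s t, mdist (γ s) (γ t) <= `|s - t|) -> continuous γ.
Proof.
move=> lip s; apply/metricType_numDomainType.cvgrPdist_lt => e e0.
near=> t; apply: le_lt_trans (lip s t) _; near: t.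
exact: (@cvgr_dist_lt _ R).
Unshelve. all: by end_near. Qed.

Section arclength.
Context {R : realType} {X : completeMetricType R}.
Variables (a b : R) (c : R -> X).
Hypothesis rect : rectifiable_curve a b c.

Let ab : a <= b. Proof. by case: rect. Qed.
Let ell t := fine (curve_length a t c).
Let L := fine (curve_length a b c).

Let lenE t : a <= t <= b -> curve_length a t c = (ell t)%:E.
Proof.
move=> /andP[at_ tb]; rewrite /ell fineK// ge0_fin_numE ?curve_length_ge0//.
case: rect => _ _; apply: le_lt_trans.
by rewrite (curve_lengthD c at_ tb) leeDl// curve_length_ge0.
Qed.

Let lenD s t : a <= s -> s <= t -> t <= b ->
  curve_length s t c = (ell t - ell s)%:E.
Proof.
move=> as_ st tb; have := curve_lengthD c as_ st.
rewrite !lenE ?as_ ?tb ?(le_trans as_) ?(le_trans _ tb)//.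
case: curve_length => [r|//|//]; rewrite -EFinD => -[->].
by congr EFin; lra.
Qed.

Let mdist_len s t : a <= s -> s <= t -> t <= b ->
  mdist (c s) (c t) <= ell t - ell s.
Proof.
by move=> as_ st tb; rewrite -lee_fin -lenD// mdist_le_curve_length.
Qed.

Let len_nd s t : a <= s -> s <= t -> t <= b -> ell s <= ell t.
Proof.
move=> as_ st tb; rewrite -subr_ge0.
exact: le_trans (mdist_ge0 _ _) (mdist_len as_ st tb).
Qed.

Let len0 : ell a = 0. Proof. by rewrite /ell curve_lengthxx. Qed.

Let cc t e : a <= t <= b -> 0 < e -> exists2 d, 0 < d &
  forall s, a <= s <= b -> `|t - s| < d -> mdist (c t) (c s) < e.
Proof.
move=> tab e0; case: rect => _ /subspace_continuousP /(_ t) cct _.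
have {cct} := cct (tab : `[a, b]%classic t).
move=> /metricType_numDomainType.cvgrPdist_lt /(_ e e0).
rewrite /= near_withinE => -[d /= d0 dP]; exists d => // s sab tsd.
exact: dP.
Qed.

Let len_right t e : a <= t < b -> 0 < e -> exists2 d, 0 < d &
  forall s, t <= s <= b -> s < t + d -> ell s <= ell t + e.
Proof.
move=> /andP[at_ tb] e0.
have tb_fin : (curve_length t b c < +oo)%E by rewrite lenD ?ltry // ltW.
have [|d d0 dP] := curve_length_right tb e0 tb_fin.
  move=> e' e'0; have [|d d0 dP] := @cc t e' _ e'0; first by rewrite at_ ltW.
  exists d => // s /andP[ts sb] std; apply: dP; first by rewrite (le_trans at_).
  by rewrite distrC ger0_norm ?subr_ge0//; lra.
exists d => // s /andP[ts sb] sd; have := dP s; rewrite ts sb => /(_ isT sd).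
by rewrite lenD// lee_fin; lra.
Qed.

Let len_left t e : a < t <= b -> 0 < e -> exists2 d, 0 < d &
  forall s, a <= s <= t -> t - d < s -> ell t - e <= ell s.
Proof.
move=> /andP[at_ tb] e0.
have at_fin : (curve_length a t c < +oo)%E by rewrite lenE ?ltry // (ltW at_).
have [|d d0 dP] := curve_length_left at_ e0 at_fin.
  move=> e' e'0; have [|d d0 dP] := @cc t e' _ e'0; first by rewrite tb ltW.
  exists d => // s /andP[ts sb] std; apply: dP; first by rewrite ts (le_trans sb).
  by rewrite ger0_norm ?subr_ge0//; lra.
exists d => // s /andP[ts sb] sd; have := dP s; rewrite ts sb => /(_ isT sd).
by rewrite lenD// lee_fin; lra.
Qed.

Let tau s := inf [set t | t \in `[a, b] /\ (s%:E <= curve_length a t c)%E].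

(** Both one-sided continuities of the length function are needed: from the
    right for the infimum to be attained, from the left for the length not to
    exceed [s] there. *)
Let tauP s : 0 <= s <= L -> a <= tau s <= b /\ ell (tau s) = s.
Proof.
move=> /andP[s0 sL]; rewrite /tau; set S := [set t | _].
have SE t : S t <-> a <= t <= b /\ s <= ell t.
  rewrite /S /= in_itv /=; split=> -[tab]; last by rewrite lenE// lee_fin.
  by rewrite lenE// lee_fin.
have Sb : S b by apply/SE; rewrite ab lexx.
have Sa : lbound S a by move=> t /SE [/andP[]].
have infS : has_inf S by split; [exists b | exists a].
have tab : a <= inf S <= b.
  by rewrite lb_le_inf ?(ge_inf _ Sb)//; [exists a|exists b].
split=> //; set t := inf S in tab *; have /andP[at_ tb] := tab.
apply/eqP; rewrite eq_le; apply/andP; split; rewrite leNgt; apply/negP => lt.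
  have a_t : a < t.
    rewrite lt_neqAle at_ andbT; apply/eqP => at'; move: lt.
    by rewrite -at' len0 ltNge s0.
  have a_tb : a < t <= b by rewrite a_t.
  have ets : 0 < ell t - s by rewrite subr_gt0.
  have [d d0 dP] := len_left a_tb ets.
  pose t1 := Num.max a (t - d / 2).
  have t1t : t1 < t by rewrite gt_max a_t /=; lra.
  have at1 : a <= t1 by rewrite le_max lexx.
  have := dP t1; rewrite at1 ltW//= => /(_ isT) H.
  suff : S t1 by move/(ge_inf infS.2); rewrite leNgt t1t.
  apply/SE; rewrite at1 (le_trans (ltW t1t))//; split => //.
  have {H} : ell t - (ell t - s) <= ell t1 by apply: H; rewrite lt_max; apply/orP; right; lra.
  lra.
have t_b : t < b.
  rewrite lt_neqAle tb andbT; apply/eqP => tb'; move: lt.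
  by rewrite tb' ltNge sL.
have at_b : a <= t < b by rewrite at_.
have est : 0 < (s - ell t) / 2 by rewrite divr_gt0// subr_gt0.
have [d d0 dP] := len_right at_b est.
have [t1 St1 t1t] := inf_adherent d0 infS.
have tt1 : t <= t1 by exact: ge_inf infS.2 _ St1.
have /SE [/andP[at1 t1b] st1] := St1.
have := dP t1; rewrite tt1 t1b => /(_ isT t1t); lra.
Qed.

Lemma arclength_param_len t : a <= t <= b ->
  arclength_param a b c (ell t) = c t.
Proof.
move=> /andP[at_ tb].
have [|/andP[atau taub] tauE] := @tauP (ell t).
  by rewrite /ell /L fine_ge0 ?curve_length_ge0//=; exact: len_nd.
have taut : tau (ell t) <= t.
  apply: ge_inf; first by exists a => x /= [/andP[]].
  by split; rewrite ?in_itv /= ?at_ ?lenE ?at_ ?lexx.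
have := mdist_len atau taut tb; rewrite tauE subrr => m0.
by apply: mdist_positivity; apply/eqP; rewrite eq_le m0 mdist_ge0.
Qed.

Lemma arclength_paramP s : 0 <= s <= L -> exists t,
  [/\ a <= t <= b, curve_length a t c = s%:E & arclength_param a b c s = c t].
Proof.
by move=> /tauP[tauab tauE]; exists (tau s); rewrite lenE ?tauE.
Qed.

End arclength.

Section subarcs.
Context {R : realType} {X : completeMetricType R}.

Lemma rectifiable_sub a b p q (c : R -> X) : rectifiable_curve a b c ->
  a <= p -> p <= q -> q <= b -> rectifiable_curve p q c.
Proof.
move=> [ab cc Lfin] ap pq qb; split => //.
  apply: continuous_subspaceW cc => x /=; rewrite !in_itv /= => /andP[px xq].
  by rewrite (le_trans ap px) (le_trans xq qb).
apply: le_lt_trans Lfin.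
rewrite (curve_lengthD c ap (le_trans pq qb)) (curve_lengthD c pq qb).
by apply: (le_trans (leeDl _ _)); [|apply: leeDr]; rewrite ?curve_length_ge0.
Qed.

(** All that is retained of a rectifiable curve of length [L]: an arc length
    parametrization, extended by constants outside [[0, L]].  The last clause
    says that subarcs are curves to which upper gradients apply; it quantifies
    over the functions, so that the same arc serves several of them. *)
Definition unit_arc (L : R) (γ : R -> X) :=
  [/\ 0 <= L, forall s t, mdist (γ s) (γ t) <= `|s - t| &
      forall Om (u g : X -> \bar R) s t, open Om -> upper_gradient Om u g ->
        0 <= s -> s <= t -> t <= L -> γ @` `[s, t] `<=` Om ->
        u (γ s) \is a fin_num -> u (γ t) \is a fin_num ->
        (`|u (γ s) - u (γ t)| <=
          \int[lebesgue_measure]_(x in `[s, t]) g (γ x))%E].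

Lemma borel_arc (γ : R -> X) (D : set R) Om (g : X -> \bar R) :
  (forall s t, mdist (γ s) (γ t) <= `|s - t|) -> measurable D ->
  open Om -> borel_fun Om g -> γ @` D `<=` Om ->
  measurable_fun D (g \o γ).
Proof.
move=> lip mD oOm mg gOm.
apply: (@measurable_comp _ _ _ _ (g_sigma_algebraType (@open X)) _ Om) => //.
  exact: sub_sigma_algebra.
apply: (@measurability _ _ _ (g_sigma_algebraType (@open X)) D γ (@open X)) => //.
move=> _ [B oB <-]; apply: measurableI => //.
apply: open_measurable; apply: open_comp => // x _.
exact: lipschitz1_continuous.
Qed.

Lemma curve_length_sub a b p q (c : R -> X) s t : rectifiable_curve a b c ->
  a <= p -> p <= q -> q <= b ->
  curve_length a p c = s%:E -> curve_length a q c = t%:E ->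
  curve_length p q c = (t - s)%:E.
Proof.
move=> rect ap pq qb ps; rewrite (curve_lengthD c ap pq) ps.
case: (curve_length p q c) => [r||] //; rewrite -EFinD => -[<-].
by congr EFin; lra.
Qed.

Lemma le_curve_length a p q (c : R -> X) : a <= p -> p <= q ->
  (curve_length a p c <= curve_length a q c)%E.
Proof.
by move=> ap pq; rewrite (curve_lengthD c ap pq) leeDl// curve_length_ge0.
Qed.

(** The subarc over [[s, t]] is the restriction of [c] between the first times
    at which it has run through the lengths [s] and [t].  The arc length
    parametrization of this restriction is a translate of that of [c], whence
    the equality of the path integrals. *)
Lemma rectifiable_unit_arc a b (c : R -> X) : rectifiable_curve a b c ->
  exists L γ, [/\ unit_arc L γ, γ 0 = c a, γ L = c b,
    γ @` `[0, L] `<=` c @` `[a, b] &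
    forall g, path_integral a b c g =
      (\int[lebesgue_measure]_(x in `[0%R, L]) g (γ x))%E].
Proof.
move=> rect; have [ab _ Lfin] := rect.
pose L := fine (curve_length a b c).
have LE : curve_length a b c = L%:E.
  by rewrite /L fineK// ge0_fin_numE// curve_length_ge0.
have L0 : 0 <= L by rewrite fine_ge0// curve_length_ge0.
pose clamp s : R := Num.max 0 (Num.min L s).
pose γ s := arclength_param a b c (clamp s).
have clampI s : 0 <= clamp s <= L.
  by rewrite /clamp le_max lexx /= ge_max L0 ge_min lexx.
have clamp_id s : 0 <= s <= L -> clamp s = s.
  by move=> /andP[s0 sL]; rewrite /clamp min_r// max_r.
have γE s : 0 <= s <= L -> γ s = arclength_param a b c s.
  by move=> sL; rewrite /γ clamp_id.
have γc t s : a <= t <= b -> curve_length a t c = s%:E -> γ s = c t.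
  move=> /[dup] tab /andP[at_ tb] ts; rewrite γE; last first.
    rewrite -!lee_fin -ts -LE curve_length_ge0//=.
    exact: (le_curve_length c at_ tb).
  by rewrite -(arclength_param_len rect tab) ts.
have ordered p q s t : a <= q -> p <= b -> s < t ->
    curve_length a p c = s%:E -> curve_length a q c = t%:E -> p <= q.
  move=> aq pb st ps qt; rewrite leNgt; apply/negP => qp.
  have := le_curve_length c aq (ltW qp).
  by rewrite ps qt lee_fin leNgt st.
have lip0 s t : 0 <= s -> s < t -> t <= L -> mdist (γ s) (γ t) <= t - s.
  move=> s0 st tL.
  have sI : 0 <= s <= L by rewrite s0 (le_trans (ltW st)).
  have tI : 0 <= t <= L by rewrite tL (le_trans s0 (ltW st)).
  have [p [/andP[ap pb] ps]] := arclength_paramP rect sI.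
  have [q [/andP[aq qb] qt]] := arclength_paramP rect tI.
  rewrite -!γE// => -> ->.
  have pq : p <= q by apply: (ordered p q s t).
  by rewrite -lee_fin -(curve_length_sub rect ap pq qb ps qt) mdist_le_curve_length.
have lip s t : mdist (γ s) (γ t) <= `|s - t|.
  wlog : s t / s <= t.
    by move=> H; have [/H//|/ltW/H] := leP s t; rewrite metric_sym distrC.
  move=> st; have [cs ct] := (clampI s, clampI t).
  have cst : clamp t - clamp s <= t - s.
    rewrite /clamp; case: (leP L s) => ?; case: (leP L t) => ?;
      case: (leP 0 s) => ?; case: (leP 0 t) => ?; case: (leP 0 L) => ?; lra.
  have : clamp s <= clamp t.
    by rewrite /clamp le_max2// le_min2.
  have -> : γ s = γ (clamp s) by rewrite {2}/γ clamp_id.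
  have -> : γ t = γ (clamp t) by rewrite {2}/γ clamp_id.
  rewrite le_eqVlt => /predU1P[->|/lip0 H]; first by rewrite mdistxx.
  rewrite distrC ger0_norm ?subr_ge0//; apply: le_trans cst; apply: H.
    by case/andP: cs.
  by case/andP: ct.
exists L, γ; split.
- split => // Om u g s t oOm [mg g0 ug] s0 st tL gOm us ut.
  move: st; rewrite le_eqVlt => /predU1P[st|st].
    by subst t; rewrite subee// abse0 set_itv1 integral_set1.
  have sI : 0 <= s <= L by rewrite s0 (le_trans (ltW st)).
  have tI : 0 <= t <= L by rewrite tL (le_trans s0 (ltW st)).
  have [p [/andP[ap pb] ps gs]] := arclength_paramP rect sI.
  have [q [/andP[aq qb] qt gt]] := arclength_paramP rect tI.
  have pq : p <= q by apply: (ordered p q s t).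
  have pqE := curve_length_sub rect ap pq qb ps qt.
  have rpq := rectifiable_sub rect ap pq qb.
  have cOm : c @` `[p, q] `<=` Om.
    move=> _ [r /= + <-]; rewrite in_itv /= => /andP[pr rq].
    have ar := le_trans ap pr; have rb := le_trans rq qb.
    have arf : curve_length a r c = (fine (curve_length a r c))%:E.
      rewrite fineK// ge0_fin_numE ?curve_length_ge0//.
      by apply: le_lt_trans Lfin; exact: (le_curve_length c ar rb).
    rewrite -(γc r _ _ arf) ?ar//; apply: gOm; exists (fine (curve_length a r c)) => //=.
    rewrite in_itv /= -!lee_fin -arf -ps -qt.
    by rewrite (le_curve_length c ap pr) (le_curve_length c ar rq).
  have := ug p q c rpq cOm.
  move: us ut; rewrite !γE// gs gt => -> -> /= /le_trans; apply.
  rewrite /path_integral pqE /= -[leRHS](ge0_integral_translation (h := g \o γ)).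
  + rewrite le_eqVlt; apply/orP; left; apply/eqP.
    apply: eq_integral => σ; rewrite inE /= in_itv /= => σI; congr g.
    have [|r [/andP[pr rq] prE ->]] := arclength_paramP rpq (s := σ).
      by rewrite pqE.
    apply/esym/γc; first by rewrite (le_trans ap pr) (le_trans rq qb).
    by rewrite (curve_lengthD c ap pr) ps prE.
  + exact: (borel_arc lip _ oOm mg gOm).
  + by move=> x xst; apply: g0; apply: gOm; exists x.
- by apply: γc; rewrite ?lexx// curve_lengthxx.
- by apply: γc; rewrite ?lexx ?ab.
- move=> _ [s /= + <-]; rewrite in_itv /= => sI.
  have [p [pI _ gp]] := arclength_paramP rect sI.
  by exists p; rewrite ?γE//= in_itv.
- move=> g; rewrite /path_integral -/L; apply: eq_integral => x.
  by rewrite inE /= in_itv /= => xI; rewrite γE.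
Qed.

(** Test the upper gradient on a constant curve, whose path integral is zero. *)
Lemma upper_gradient_fin (Om : set X) (u g : X -> \bar R) x :
  upper_gradient Om u g -> Om x -> u x \is a fin_num.
Proof.
move=> [_ _ ug] Omx; apply/negPn/negP => ux.
have rect : rectifiable_curve 0 0 (cst x).
  split => //; last by rewrite curve_lengthxx ltry.
  by apply: continuous_subspaceT => y; exact: cvg_cst.
have cOm : cst x @` `[(0 : R), 0] `<=` Om by move=> _ [y _ <-].
have := ug 0 0 (cst x) rect cOm.
by rewrite /= (negbTE ux) /= /path_integral curve_lengthxx /= set_itv1 integral_set1.
Qed.

Lemma upper_gradient_arcP (Om : set X) (w G : X -> \bar R) :
  borel_fun Om G -> (forall x, Om x -> 0 <= G x)%E ->
  (forall x, Om x -> w x \is a fin_num) ->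
  (forall L γ, unit_arc L γ -> γ @` `[0, L] `<=` Om ->
    (`|w (γ 0%R) - w (γ L)| <=
     \int[lebesgue_measure]_(x in `[0%R, L]) G (γ x))%E) ->
  upper_gradient Om w G.
Proof.
move=> mG G0 wfin arc; split => // a b c rect cOm.
have [L [γ [ua ga gb gc ->]]] := rectifiable_unit_arc rect.
have [ab _ _] := rect.
rewrite !wfin /=; last 2 first.
- by apply: cOm; exists b => //=; rewrite in_itv /= ab lexx.
- by apply: cOm; exists a => //=; rewrite in_itv /= ab lexx.
by rewrite -ga -gb; apply: arc => //; exact: subset_trans cOm.
Qed.

End subarcs.

(** * Integrals over an interval *)

Section integrals_on_the_line.
Context {R : realType}.
Implicit Types (h : R -> \bar R) (W : R -> R) (a b : R).
Local Notation lambda := (@lebesgue_measure R).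

(** Absolute continuity of the integral: [h] is finite almost everywhere, which
    reduces the claim to a real-valued function. *)
Lemma ge0_integral_small d (T : measurableType d) (mu : {measure set T -> \bar R})
    (D : set T) (h : T -> \bar R) (e : R) :
  measurable D -> mu.-integrable D h -> (forall x, D x -> 0 <= h x)%E -> 0 < e ->
  exists2 del, 0 < del & forall A, measurable A -> A `<=` D ->
    (mu A < del%:E -> \int[mu]_(x in A) h x < e%:E)%E.
Proof.
move=> mD ih h0 e0; pose f x := fine ((h \_ D) x).
have ihD : mu.-integrable setT (h \_ D) := (integrable_mkcond h mD).1 ih.
have hf : {ae mu, forall x, (h \_ D) x = (f x)%:E}.
  have := integrable_ae measurableT ihD; apply: filterS => x /(_ I) fx.
  by rewrite /f fineK.
have mf : measurable_fun setT (EFin \o f).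
  by apply/measurable_EFinP; apply: measurableT_comp => //; exact: measurable_int ihD.
have intf : mu.-integrable setT (EFin \o f).
  apply/integrableP; split => //.
  rewrite (_ : integral _ _ _ = (\int[mu]_x `|(h \_ D) x|)%E).
    by case/integrableP : ihD.
  apply: ae_eq_integral => //.
  - exact: measurableT_comp.
  - by apply: measurableT_comp => //; exact: measurable_int ihD.
  - by apply: filterS hf => x /= ->.
have [del [del0 Hdel]] := integral_normr_continuous intf e0.
exists del => // A mA AD muA.
have -> : (\int[mu]_(x in A) h x = \int[mu]_(x in A) (`|f x|)%:E)%E.
  apply: ae_eq_integral => //.
  - exact: measurable_funS (measurable_int mu ih).
  - apply: (@measurable_funS _ _ _ _ setT) => //.
    by apply/measurable_EFinP; apply: measurableT_comp => //; exact/measurable_EFinP.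
  - apply: filterS hf => x /= fx Ax.
    have Dx := AD _ Ax; rewrite patchE mem_set// in fx.
    by rewrite -abse_EFin -fx gee0_abs// h0.
have ifA : mu.-integrable A (fun x => (`|f x|)%:E).
  apply: (@integrableS _ _ _ _ setT) => //.
  exact: (integrable_abse intf).
have := Hdel A mA muA; rewrite /Rintegral -lte_fin fineK//.
exact: integrable_fin_num.
Qed.

Lemma closed_itv_extrema (S : set R) a b : closed S -> S `<=` `[a, b] ->
  S !=set0 ->
  (exists2 z, S z & forall s, S s -> z <= s) /\
  (exists2 z, S z & forall s, S s -> s <= z).
Proof.
move=> clS Sab S0.
have cS : compact S := subclosed_compact clS (@segment_compact R a b) Sab.
have cid : {within S, continuous (@idfun R)}.
  by apply: continuous_subspaceT => x; exact: cvg_id.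
split.
  have [z zS zP] := compact_EVT_min S0 cS cid; exists z; first by rewrite -inE.
  by move=> s Ss; apply: zP; rewrite inE.
have [z zS zP] := compact_EVT_max S0 cS cid; exists z; first by rewrite -inE.
by move=> s Ss; apply: zP; rewrite inE.
Qed.

(** One-dimensional form of the locality of upper gradients, with [h] the upper
    gradient along an arc and [k] a density which is only required to dominate
    [h] where [W > m].  [W] is continuous, so [{W <= m}] is closed: from an
    endpoint with [W > m], the drop of [W] to level [m] takes place before the
    nearest point of this set, on an interval on which [h <= k]. *)
Lemma excess_le_integral (L m : R) (W : R -> R) (h k : R -> \bar R) :
  0 <= L -> measurable_fun `[0, L] h -> (forall s, s \in `[0, L] -> (0 <= h s)%E) ->
  measurable_fun `[0, L] k -> (forall s, s \in `[0, L] -> (0 <= k s)%E) ->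
  (\int[lambda]_(x in `[0%R, L]) h x < +oo)%E ->
  (forall s t, 0 <= s -> s <= t -> t <= L ->
    (`|W s - W t|%:E <= \int[lambda]_(x in `[s, t]) h x)%E) ->
  (forall s, s \in `[0, L] -> m < W s -> (h s <= k s)%E) ->
  (`|Num.max (W 0%R) m - Num.max (W L) m|%:E <=
    \int[lambda]_(x in `[0%R, L]) k x)%E.
Proof.
move=> L0 mh h0 mk k0 hfin Wh hk.
set I : \bar R := (\int[lambda]_(x in `[0%R, L]) k x)%E.
have I0 : (0 <= I)%E by apply: integral_ge0 => x /= xL; exact: k0.
(* the endpoints of the interval, where [W <= m] may hold, are negligible *)
have gap (p q : R) : 0 <= p -> p <= q -> q <= L ->
    (forall s, p < s < q -> m < W s) -> (`|W p - W q|%:E <= I)%E.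
  move=> p0 pq qL pqW; apply: le_trans (Wh p q p0 pq qL) _.
  have sub : `]p, q[ `<=` `[0, L].
    move=> x /=; rewrite !in_itv /= => /andP[px xq].
    by rewrite (le_trans p0 (ltW px)) (le_trans (ltW xq) qL).
  rewrite integral_itv_bndoo; last exact: measurable_funS mh.
  apply: (@le_trans _ _ (\int[lambda]_(x in `]p, q[) k x)%E).
    apply: ge0_le_integral => //.
    - by move=> x /sub; exact: h0.
    - exact: measurable_funS mh.
    - exact: measurable_funS mk.
    - move=> x /[dup] /sub xL; rewrite /= in_itv /= => xpq.
      by apply: hk => //; exact: pqW.
  by apply: ge0_subset_integral => //.
have cW (x e : R) : x \in `[0, L] -> 0 < e -> exists2 del, 0 < del &
    forall s, s \in `[0, L] -> `|x - s| < del -> `|W x - W s| < e.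
  rewrite in_itv /= => /andP[x0 xL] e0.
  have ih : lambda.-integrable `[0, L] h.
    apply/integrableP; split => //; apply: le_lt_trans hfin.
    rewrite le_eqVlt; apply/orP; left; apply/eqP.
    by apply: eq_integral => y; rewrite inE /= => yL; rewrite gee0_abs// h0.
  have [del del0 delP] := @ge0_integral_small _ _ lambda `[0, L] h e (measurable_itv _) ih h0 e0.
  have key (s t : R) : 0 <= s -> s <= t -> t <= L -> t - s < del -> `|W s - W t| < e.
    move=> s0 st tL ts; rewrite -lte_fin; apply: le_lt_trans (Wh s t s0 st tL) _.
    apply: delP => //.
      move=> y /=; rewrite !in_itv /= => /andP[sy yt].
      by rewrite (le_trans s0 sy) (le_trans yt tL).
    have /= := lebesgue_measure_itv `[s, t]; rewrite lte_fin => ->.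
    by case: ifP => _; rewrite ?lte_fin// -EFinD lte_fin.
  exists del => // s; rewrite in_itv /= => /andP[s0 sL].
  have [xs|sx] := leP x s.
    rewrite distrC ger0_norm ?subr_ge0// => xs'.
    exact: key.
  rewrite ger0_norm ?subr_ge0 ?ltW// => sx'; rewrite distrC.
  by apply: key => //; exact: ltW.
pose S := [set s : R | s \in `[0, L] /\ W s <= m].
have clS : closed S.
  move=> x clx; have xL : x \in `[0, L].
    have cl : closure `[0, L] x by apply: closureS clx => y [].
    have cL : closed [set` `[0, L]] by exact: itv_closed.
    by have := (closure_id _).1 cL; move: cl => /[swap] <-.
  split => //; rewrite leNgt; apply/negP => mW.
  have Wm : 0 < W x - m by rewrite subr_gt0.
  have [del del0 delP] := cW x _ xL Wm.
  have [s [[sL sm] xs]] := clx _ (nbhsx_ballx x _ del0).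
  by have := delP s sL xs; rewrite ltr_norml => /andP[_]; lra.
have upper (A B : R) : m <= A -> m <= B -> ((A - m)%:E <= I)%E -> ((B - m)%:E <= I)%E ->
    (`|A - B|%:E <= I)%E.
  move=> mA mB AI BI; have [AB|BA] := leP A B.
    by rewrite distrC ger0_norm ?subr_ge0// (le_trans _ BI)// lee_fin lerD2l lerN2.
  by rewrite ger0_norm ?subr_ge0 ?(ltW BA)// (le_trans _ AI)// lee_fin lerD2l lerN2.
have [[s0 S0]|nS] := pselect (S !=set0); last first.
  have Wm s : 0 <= s <= L -> m < W s.
    move=> sL; rewrite ltNge; apply/negP => sm; apply: nS; exists s.
    by split; rewrite ?in_itv.
  have mW0 : m <= W 0 by apply/ltW/Wm; rewrite lexx.
  have mWL : m <= W L by apply/ltW/Wm; rewrite L0 lexx.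
  rewrite (max_l mW0) (max_l mWL); apply: gap => // s /andP[? ?].
  by apply: Wm; apply/andP; split; exact: ltW.
have SL : S `<=` `[0, L] by move=> s [].
have [[z [zL zm] zP] [y [yL ym] yP]] := closed_itv_extrema clS SL (ex_intro _ _ S0).
apply: upper; rewrite ?le_max ?lexx ?orbT//.
  have [W0m|mW0] := leP (W 0) m; first by rewrite subrr.
  move: zL; rewrite in_itv /= => /andP[z0 zL].
  apply: (@le_trans _ _ `|W 0 - W z|%:E); first by rewrite lee_fin ler_normr; lra.
  apply: gap => // s /andP[s0' sz]; rewrite ltNge; apply/negP => sm.
  have : S s by split => //; rewrite in_itv /= ltW//= (le_trans (ltW sz)).
  by move=> /zP; rewrite leNgt sz.
have [WLm|mWL] := leP (W L) m; first by rewrite subrr.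
move: yL; rewrite in_itv /= => /andP[y0 yL].
apply: (@le_trans _ _ `|W y - W L|%:E); first by rewrite lee_fin distrC ler_normr; lra.
apply: gap => // s /andP[ys sL]; rewrite ltNge; apply/negP => sm.
have : S s by split => //; rewrite in_itv /= (ltW sL) (le_trans y0 (ltW ys)).
by move=> /yP; rewrite leNgt ys.
Qed.

End integrals_on_the_line.

(** * Calculus of upper gradients *)

Section upper_gradient_calculus.
Context {R : realType} {X : completeMetricType R}.
Implicit Types (Om U : set X) (u v w g h : X -> \bar R) (γ : R -> X).
Local Notation lambda := (@lebesgue_measure R).

Lemma arc_upper_gradient Om u g L γ s t : open Om -> upper_gradient Om u g ->
  unit_arc L γ -> γ @` `[0, L] `<=` Om -> 0 <= s -> s <= t -> t <= L ->
  (`|u (γ s) - u (γ t)| <= \int[lambda]_(x in `[s, t]) g (γ x))%E.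
Proof.
move=> oOm ug [L0 lip arc] gOm s0 st tL.
apply: (arc _ _ _ _ _ oOm ug) => //.
- move=> _ [x /= + <-]; rewrite in_itv /= => /andP[sx xt]; apply: gOm.
  by exists x => //=; rewrite in_itv /= (le_trans s0 sx) (le_trans xt tL).
- apply: (upper_gradient_fin ug); apply: gOm; exists s => //=.
  by rewrite in_itv /= s0 (le_trans st).
- apply: (upper_gradient_fin ug); apply: gOm; exists t => //=.
  by rewrite in_itv /= tL (le_trans s0).
Qed.

Lemma arc_upper_gradient_ends Om u g L γ : open Om -> upper_gradient Om u g ->
  unit_arc L γ -> γ @` `[0, L] `<=` Om ->
  (`|u (γ 0%R) - u (γ L)| <= \int[lambda]_(x in `[0%R, L]) g (γ x))%E.
Proof.
by move=> oOm ug arc gOm; have [L0 _ _] := arc; apply: arc_upper_gradient ug arc gOm _ _ _.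
Qed.

Lemma measurable_arc Om g L γ : open Om -> borel_fun Om g ->
  unit_arc L γ -> γ @` `[0, L] `<=` Om -> measurable_fun `[0, L] (g \o γ).
Proof. by move=> oOm mg [_ lip _] gOm; exact: borel_arc oOm mg gOm. Qed.

Lemma upper_gradient_eq Om u v g : (forall x, Om x -> u x = v x) ->
  upper_gradient Om u g -> upper_gradient Om v g.
Proof.
move=> uv [mg g0 ug]; split => // a b c rect cOm.
have [ab _ _] := rect.
have := ug a b c rect cOm; rewrite !uv//; apply: cOm.
  by exists b => //=; rewrite in_itv /= ab lexx.
by exists a => //=; rewrite in_itv /= ab lexx.
Qed.

Lemma upper_gradient_lipschitz Om (D : X -> R) (K : R) : 0 <= K ->
  (forall x y, `|D x - D y| <= K * mdist x y) ->
  upper_gradient Om (EFin \o D) (cst K%:E).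
Proof.
move=> K0 lipD; apply: upper_gradient_arcP => //.
  exact: measurable_cst.
move=> L γ [L0 lip _] gOm /=.
rewrite integral_cst//= lebesgue_measure_itv /= lte_fin.
have -> : (if (0 < L)%R then L%:E - 0%:E else 0)%E = L%:E.
  by case: ltP => [_|]; [rewrite sube0|move=> L0'; congr EFin; apply/eqP; rewrite eq_le L0 L0'].
rewrite -EFinM -[leLHS]/(`|D (γ 0) - D (γ L)|%:E) lee_fin; apply: le_trans (lipD _ _) _.
rewrite ler_wpM2l//; apply: le_trans (lip _ _) _.
by rewrite sub0r normrN ger0_norm.
Qed.

Lemma upper_gradientD Om u v g h : open Om ->
  upper_gradient Om u g -> upper_gradient Om v h ->
  upper_gradient Om (fun x => u x + v x)%E (fun x => g x + h x)%E.
Proof.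
move=> oOm ug vh; have [mg g0 _] := ug; have [mh h0 _] := vh.
have uf x := upper_gradient_fin ug (x := x).
have vf x := upper_gradient_fin vh (x := x).
apply: upper_gradient_arcP.
- exact: emeasurable_funD.
- by move=> x Ox; rewrite adde_ge0 ?g0 ?h0.
- by move=> x Ox; rewrite fin_numD uf ?vf.
move=> L γ arc gOm; have [L0 _ _] := arc.
have O0 : Om (γ 0) by apply: gOm; exists 0 => //=; rewrite in_itv /= lexx.
have OL : Om (γ L) by apply: gOm; exists L => //=; rewrite in_itv /= lexx andbT.
rewrite ge0_integralD//.
- apply: (@le_trans _ _ (`|u (γ 0%R) - u (γ L)| + `|v (γ 0%R) - v (γ L)|)%E).
    move: (uf _ O0) (uf _ OL) (vf _ O0) (vf _ OL).
    case: (u (γ 0)) => [a||] //; case: (u (γ L)) => [b||] //.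
    case: (v (γ 0)) => [a'||] //; case: (v (γ L)) => [b'||] // _ _ _ _.
    suff : `|a + a' - (b + b')| <= `|a - b| + `|a' - b'| by rewrite -lee_fin.
    by rewrite opprD addrACA ler_normD.
  by apply: leeD; exact: arc_upper_gradient_ends arc gOm.
- by move=> x xL; apply: g0; apply: gOm; exists x.
- exact: measurable_arc oOm mg arc gOm.
- by move=> x xL; apply: h0; apply: gOm; exists x.
- exact: measurable_arc oOm mh arc gOm.
Qed.

Lemma upper_gradient_contract Om u g (phi : \bar R -> \bar R) : open Om ->
  (forall a, a \is a fin_num -> phi a \is a fin_num) ->
  (forall a b, a \is a fin_num -> b \is a fin_num ->
    `|phi a - phi b| <= `|a - b|)%E ->
  upper_gradient Om u g -> upper_gradient Om (phi \o u) g.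
Proof.
move=> oOm phif phi1 ug; have [mg g0 _] := ug.
have uf x := upper_gradient_fin ug (x := x).
apply: upper_gradient_arcP => //; first by move=> x Ox; apply/phif/uf.
move=> L γ arc gOm; have [L0 _ _] := arc.
have O0 : Om (γ 0) by apply: gOm; exists 0 => //=; rewrite in_itv /= lexx.
have OL : Om (γ L) by apply: gOm; exists L => //=; rewrite in_itv /= lexx andbT.
apply: le_trans (arc_upper_gradient_ends oOm ug arc gOm).
by apply: phi1; exact: uf.
Qed.

(** Two features distinguish this from the ideal gradient [\1_(u > m) * g].  The
    superlevel set need not be Borel, hence the Borel set [H] around it.  And on
    curves along which the integral of [g] is infinite nothing is known about
    [u]; the term [e * g] keeps the path integral infinite on them. *)
Lemma upper_gradient_max Om u g (m e : R) (H : set X) : open Om -> 0 < e ->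
  <<s @open X >> H -> (forall x, Om x -> m%:E < u x -> H x)%E ->
  upper_gradient Om u g ->
  upper_gradient Om (fun x => maxe (u x) m%:E)
    (fun x => (\1_H x + e)%:E * g x)%E.
Proof.
move=> oOm e0 mH uH ug; have [mg g0 _] := ug.
have uf x := upper_gradient_fin ug (x := x).
have mOm : (@measurable _ (g_sigma_algebraType (@open X))) Om.
  exact: sub_sigma_algebra.
set k := (fun x => _ * _)%E.
have mk : borel_fun Om k.
  apply: emeasurable_funM => //; apply/measurable_EFinP.
  by apply: measurable_funD => //; exact: measurable_indic.
have k0 x : Om x -> (0 <= k x)%E.
  by move=> Ox; rewrite mule_ge0 ?g0// lee_fin addr_ge0// ltW.
apply: upper_gradient_arcP => //.
  by move=> x /uf; case: (u x) => // r _; rewrite -EFin_max.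
move=> L γ arc gOm; have [L0 _ _] := arc.
have gO s : s \in `[0, L] -> Om (γ s) by move=> sL; apply: gOm; exists s.
have O0 : Om (γ 0) by apply: gO; rewrite in_itv /= lexx.
have OL : Om (γ L) by apply: gO; rewrite in_itv /= lexx andbT.
have mgγ := measurable_arc oOm mg arc gOm.
have mkγ := measurable_arc oOm mk arc gOm.
set I := integral _ _ _.
have [gfin|] := ltP (\int[lambda]_(x in `[0%R, L]) g (γ x))%E +oo%E; last first.
  (* nothing is known about [u] along the arc, but [e * g] is not integrable *)
  rewrite leye_eq => /eqP goo.
  suff -> : I = +oo%E by rewrite leey.
  apply/eqP; rewrite -leye_eq.
  apply: (@le_trans _ _ (\int[lambda]_(x in `[0%R, L]) (e%:E * g (γ x)))%E).
    rewrite ge0_integralZl//; last 2 first.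
      by move=> x xL; apply/g0/gO.
      by rewrite lee_fin ltW.
    by rewrite goo gt0_muley ?lte_fin.
  apply: ge0_le_integral => //.
  - by move=> x xL; rewrite mule_ge0 ?lee_fin ?(ltW e0)//; apply/g0/gO.
  - exact: emeasurable_funM.
  - move=> x xL; rewrite lee_wpmul2r//; first exact/g0/gO.
    by rewrite lee_fin lerDr.
have -> : maxe (u (γ 0)) m%:E = (Num.max (fine (u (γ 0))) m)%:E.
  by rewrite EFin_max fineK ?uf.
have -> : maxe (u (γ L)) m%:E = (Num.max (fine (u (γ L))) m)%:E.
  by rewrite EFin_max fineK ?uf.
rewrite -EFinB abse_EFin.
apply: (excess_le_integral (W := fun s => fine (u (γ s))) L0 mgγ) => //.
- by move=> s sL; exact/g0/gO.
- by move=> s sL; exact/k0/gO.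
- move=> s t s0 st tL.
  have := arc_upper_gradient oOm ug arc gOm s0 st tL.
  rewrite -{1}(@fineK _ (u (γ s))) -1?{1}(@fineK _ (u (γ t)))//; apply/uf/gO;
    rewrite in_itv /=; apply/andP; split => //; first exact: le_trans st.
  exact: le_trans st tL.
- move=> s sL ms; rewrite /k; apply: lee_pemull; first exact/g0/gO.
  rewrite indicE mem_set; first by rewrite lee_fin lerDl ltW.
  apply: uH; first exact: gO.
  by rewrite -(fineK (uf _ (gO _ sL))) lte_fin.
Qed.

(** A curve which does not stay in [{D < 1}] meets [{D = 1}], still inside [U],
    where [w = 0].  The value of [w] at each end is then paid for by the piece
    of the curve between this end and the nearest such point. *)
Lemma upper_gradient_zero_extension U w G (D : X -> R) (K : R) : open U ->
  0 <= K -> (forall x y, `|D x - D y| <= K * mdist x y) ->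
  (forall x, D x <= 1 -> U x) ->
  (forall x, U x -> 0 <= w x)%E -> (forall x, U x -> 1 <= D x -> w x = 0%E) ->
  upper_gradient U w G ->
  upper_gradient setT (w \_ [set x | D x < 1]) (G \_ U).
Proof.
move=> oU K0 lipD DU w0 wD ug; have [mG G0 _] := ug.
have wf x := upper_gradient_fin ug (x := x).
have mU : (@measurable _ (g_sigma_algebraType (@open X))) U.
  exact: sub_sigma_algebra.
have mGU : borel_fun setT (G \_ U) by apply/(measurable_restrictT _ mU).
have GU0 x : (0 <= (G \_ U) x)%E.
  by rewrite patchE; case: ifPn => // /set_mem/G0.
set w' := w \_ _.
have w'0 x : (0 <= w' x)%E.
  rewrite /w' patchE; case: ifPn => // /set_mem /= Dx.
  by apply: w0; apply: DU; exact: ltW.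
have w'f x : w' x \is a fin_num.
  rewrite /w' patchE; case: ifPn => // /set_mem /= Dx.
  by apply: wf; apply: DU; exact: ltW.
have w'E x : D x <= 1 -> w' x = w x.
  rewrite /w' patchE => Dx; case: ifPn => // /negP H.
  rewrite wD//; first exact: DU.
  by rewrite leNgt; apply/negP => D1; apply: H; rewrite inE.
have w'D x : 1 <= D x -> w' x = 0%E.
  by move=> Dx; rewrite /w' patchE memNset//= ltNge Dx.
apply: upper_gradient_arcP => //.
move=> L γ arc _; have [L0 lip sub] := arc.
set I := integral _ _ _.
have piece s t : 0 <= s -> s <= t -> t <= L ->
    (forall r, s <= r <= t -> D (γ r) <= 1) ->
    (`|w' (γ s) - w' (γ t)| <= I)%E.
  move=> s0 st tL D1; have gU : γ @` `[s, t] `<=` U.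
    by move=> _ [r /= + <-]; rewrite in_itv /= => /D1/DU.
  rewrite !w'E ?D1 ?lexx ?st//.
  apply: le_trans (sub _ _ _ _ _ oU ug s0 st tL gU _ _) _.
  - by apply/wf/DU/D1; rewrite lexx.
  - by apply/wf/DU/D1; rewrite lexx st.
  apply: (@le_trans _ _ (\int[lambda]_(x in `[s, t]) (G \_ U) (γ x))%E).
    rewrite le_eqVlt; apply/orP; left; apply/eqP; apply: eq_integral => r.
    by rewrite inE => rst; rewrite patchE mem_set//; apply: gU; exists r.
  apply: ge0_subset_integral => //.
    exact: (measurable_arc openT mGU arc).
  move=> r /=; rewrite !in_itv /= => /andP[sr rt].
  by rewrite (le_trans s0 sr) (le_trans rt tL).
have cD (s e : R) : 0 < e -> exists2 del, 0 < del & forall t, `|s - t| < del ->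
    `|D (γ s) - D (γ t)| < e.
  move=> e0; exists (e / (K + 1)); first by rewrite divr_gt0// ltr_wpDl.
  move=> t; rewrite ltr_pdivlMr ?ltr_wpDl// => st.
  apply: le_lt_trans st; apply: le_trans (lipD _ _) _; rewrite mulrC.
  by apply: ler_pM; rewrite ?mdist_ge0 ?lip ?lerDl.
pose S := [set s : R | s \in `[0, L] /\ 1 <= D (γ s)].
have clS : closed S.
  move=> x clx; have xL : x \in `[0, L].
    have cl : closure `[0, L] x by apply: closureS clx => y [].
    have cL : closed [set` `[0, L]] by exact: itv_closed.
    by have := (closure_id _).1 cL; move: cl => /[swap] <-.
  split => //; rewrite leNgt; apply/negP => D1.
  have e0 : 0 < 1 - D (γ x) by rewrite subr_gt0.
  have [del del0 delP] := cD x _ e0.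
  have [s [[sL sm] xs]] := clx _ (nbhsx_ballx x _ del0).
  by have := delP s xs; rewrite ltr_norml => /andP[]; lra.
have upper (A B : \bar R) : (A \is a fin_num -> B \is a fin_num -> 0 <= A ->
    0 <= B -> A <= I -> B <= I -> `|A - B| <= I)%E.
  case: A => [a||] //; case: B => [b||] // _ _; rewrite !lee_fin => a0 b0 aI bI.
  have [ab|ba] := leP a b.
    apply: le_trans bI; rewrite -[leLHS]/(`|a - b|%:E) lee_fin distrC.
    by rewrite ger0_norm ?subr_ge0//; lra.
  apply: le_trans aI; rewrite -[leLHS]/(`|a - b|%:E) lee_fin.
  by rewrite ger0_norm ?subr_ge0; lra.
have [[s0 S0]|nS] := pselect (S !=set0); last first.
  apply: piece; rewrite ?lexx// => r rL; rewrite leNgt; apply/negP => Dr.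
  by apply: nS; exists r; split; rewrite ?in_itv//= ltW.
have SL : S `<=` `[0, L] by move=> s [].
have [[z [zL zm] zP] [y [yL ym] yP]] := closed_itv_extrema clS SL (ex_intro _ _ S0).
have I0 : (0 <= I)%E by apply: integral_ge0.
(* first and last exit points still lie where D <= 1, by continuity *)
have exit x : x \in `[0, L] -> (forall e, 0 < e ->
    exists2 s, `|x - s| < e & D (γ s) < 1) -> D (γ x) <= 1.
  move=> xL H; rewrite leNgt; apply/negP => D1.
  have e0 : 0 < D (γ x) - 1 by rewrite subr_gt0.
  have [del del0 delP] := cD x _ e0.
  have [s xs Ds] := H _ del0.
  by have := delP s xs; rewrite ltr_norml => /andP[_]; lra.
apply: upper => //.
  have [D0|D0] := leP 1 (D (γ 0)); first by rewrite w'D.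
  have before s : 0 <= s < z -> D (γ s) < 1.
    move=> /andP[s0' sz]; rewrite ltNge; apply/negP => Ds.
    have : S s.
      split => //; move: zL; rewrite !in_itv /= s0' => /andP[_].
      exact: le_trans (ltW sz).
    by move/zP; rewrite leNgt sz.
  move: (zL); rewrite in_itv /= => /andP[z0 zL'].
  have z_gt0 : 0 < z.
    by rewrite lt_neqAle z0 andbT; apply/eqP => zE; move: zm; rewrite -zE leNgt D0.
  have Dz : D (γ z) <= 1.
    apply: exit => // e e0; pose s := Num.max 0 (z - e / 2).
    have sz : s < z by rewrite /s gt_max z_gt0 /=; lra.
    have s0' : 0 <= s by rewrite /s le_max lexx.
    have se : z - e / 2 <= s by rewrite /s le_max lexx orbT.
    by exists s; [rewrite ger0_norm ?subr_ge0 ?(ltW sz)//; lra|apply: before; rewrite s0'].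
  have := piece 0 z (lexx _) z0 zL'.
  rewrite [w' (γ z)]w'D// sube0 gee0_abs//; apply => r /andP[r0].
  by rewrite le_eqVlt => /predU1P[->//|rz]; apply/ltW/before; rewrite r0.
have [D0|D0] := leP 1 (D (γ L)); first by rewrite w'D.
have after s : y < s <= L -> D (γ s) < 1.
  move=> /andP[ys sL]; rewrite ltNge; apply/negP => Ds.
  have : S s.
    split => //; move: yL; rewrite !in_itv /= sL andbT => /andP[y0 _].
    exact: le_trans y0 (ltW ys).
  by move/yP; rewrite leNgt ys.
move: (yL); rewrite in_itv /= => /andP[y0 yL'].
have y_ltL : y < L.
  by rewrite lt_neqAle yL' andbT; apply/eqP => yE; move: ym; rewrite yE leNgt D0.
have Dy : D (γ y) <= 1.
  apply: exit => // e e0; pose s := Num.min L (y + e / 2).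
  have ys : y < s by rewrite /s lt_min y_ltL /=; lra.
  have sL : s <= L by rewrite /s ge_min lexx.
  have se : s <= y + e / 2 by rewrite /s ge_min lexx orbT.
  by exists s; [rewrite distrC ger0_norm ?subr_ge0 ?(ltW ys)//; lra|apply: after; rewrite ys].
have := piece y L y0 yL' (lexx _).
rewrite [w' (γ y)]w'D// sub0e abseN gee0_abs//; apply => r /andP[+ rL].
by rewrite le_eqVlt => /predU1P[<-//|yr]; apply/ltW/after; rewrite yr.
Qed.

End upper_gradient_calculus.

(** * Lipschitz functions, compactness and doubling measures *)

Section lipschitz_functions.
Context {R : realType} {X : completeMetricType R}.

Lemma lipschitz_continuous (D : X -> R) (K : R) : 0 <= K ->
  (forall x y, `|D x - D y| <= K * mdist x y) -> continuous D.
Proof.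
move=> K0 lipD x; apply/cvgrPdist_lt => e e0.
have K1 : 0 < K + 1 by rewrite ltr_wpDl.
near=> y; apply: le_lt_trans (lipD x y) _.
have : mdist x y < e / (K + 1).
  near: y; have := nbhsx_ballx x (e / (K + 1)) (divr_gt0 e0 K1).
  by apply: filterS => y; rewrite ballEmdist.
rewrite ltr_pdivlMr//; apply: le_lt_trans.
by rewrite mulrC ler_wpM2l ?mdist_ge0// lerDl.
Unshelve. all: by end_near. Qed.

Lemma lipschitz_open (D : X -> R) (K c : R) : 0 <= K ->
  (forall x y, `|D x - D y| <= K * mdist x y) -> open [set x | D x < c].
Proof.
move=> K0 /(lipschitz_continuous K0) cD.
rewrite (_ : [set x | _] = D @^-1` [set y | y < c])//.
by apply: open_comp => // x _; exact: cD.
Qed.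

Lemma lipschitz_closed (D : X -> R) (K c : R) : 0 <= K ->
  (forall x y, `|D x - D y| <= K * mdist x y) -> closed [set x | D x <= c].
Proof.
move=> K0 /(lipschitz_continuous K0) cD.
rewrite (_ : [set x | _] = D @^-1` [set y | y <= c])//.
by apply: preimage_closed => // x _; exact: cD.
Qed.

Lemma mdist_lipschitz (x y z : X) : `|mdist x y - mdist x z| <= mdist y z.
Proof.
rewrite ler_norml; apply/andP; split.
  have := metric_triangle x y z; lra.
have := metric_triangle x z y; rewrite (metric_sym z y); lra.
Qed.

Lemma closed_cball (x : X) (r : R) : closed [set y | mdist x y <= r].
Proof.
by apply: (@lipschitz_closed _ 1) => // y z; rewrite mul1r mdist_lipschitz.
Qed.

Lemma open_ball (x : X) (r : R) : open (ball x r).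
Proof.
rewrite ballEmdist.
by apply: (@lipschitz_open _ 1) => // y z; rewrite mul1r mdist_lipschitz.
Qed.

(** An ultrafilter on [K] contains a ball of each radius, one of finitely many
    which cover [K]; so it is Cauchy and converges. *)
Lemma totally_bounded_compact (K : set X) : closed K ->
  (forall e, 0 < e -> exists s : seq X, forall y, K y ->
     exists2 x, x \in s & mdist x y < e) -> compact K.
Proof.
move=> clK tb; rewrite compact_ultra => F UF FK.
have PF : ProperFilter F by exact: ultra_proper.
have pick (s : seq X) e : F [set y | exists2 x, x \in s & mdist x y < e] ->
    exists x, F (ball x e).
  elim: s => [|x s IH] FS.
    exfalso; apply: (@filter_not_empty _ F).
    by apply: filterS FS => y [].
  have [Fx|Fx] := in_ultra_setVsetC (ball x e) UF; first by exists x.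
  apply: IH; apply: filterS (filterI FS Fx) => y [[x']].
  rewrite in_cons => /predU1P[->|xs x'y] nx; last by exists x'.
  by move=> x'y; exfalso; apply: x'y; rewrite ballEmdist.
have cF : cauchy F.
  apply: cauchy_exP => e e0; have [s Ks] := tb e e0.
  apply: (pick s); apply: filterS FK => y Ky; have [x xs xy] := Ks y Ky.
  by exists x.
have Fl : cvg F := @cauchy_cvg X F PF cF.
exists (lim F); split => //.
by apply: clK => B /Fl FB; apply: (@filter_ex _ F); exact: filterI.
Qed.

End lipschitz_functions.

Section measure_theory.
Context {R : realType} {X : completeMetricType R}.
Variable mu : {outer_measure set X -> \bar R}.
Hypotheses (mu_regular : borel_regular mu) (mu_doubling : doubling mu).
Local Notation Y := (caratheodory_type mu).
Local Notation nu := (cara_measure mu).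
Implicit Types (x : X) (r e : R).

Lemma borel_cara (A : set X) : <<s @open X >> A -> @measurable _ Y A.
Proof. by case: mu_regular => H _; exact: H. Qed.

Lemma open_cara (A : set X) : open A -> @measurable _ Y A.
Proof. by move=> oA; apply: borel_cara; exact: sub_sigma_algebra. Qed.

Lemma borel_fun_cara (Om : set X) (g : X -> \bar R) : open Om ->
  borel_fun Om g -> @measurable_fun _ _ Y _ Om g.
Proof.
move=> oOm mg _ B mB; apply: borel_cara.
have mOm : @measurable _ (g_sigma_algebraType (@open X)) Om.
  exact: sub_sigma_algebra.
exact: (mg mOm B mB).
Qed.

Lemma ball_gt0 x r : 0 < r -> (0 < mu (ball x r))%E.
Proof.
move=> r0; case: mu_doubling => cd cd0 /(_ x (r / 2)); rewrite divr_gt0//.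
by move=> /(_ isT) [+ _ _]; rewrite (_ : 2 * (r / 2) = r)//; lra.
Qed.

Lemma ball_ltoo x r : (mu (ball x r) < +oo)%E.
Proof.
have [r0|r0] := ltP 0 r.
  case: mu_doubling => cd cd0 /(_ x (r / 2)); rewrite divr_gt0//.
  move=> /(_ isT) [_ + H]; rewrite (_ : 2 * (r / 2) = r); last by lra.
  by move/le_lt_trans; apply.
rewrite (_ : ball x r = set0) ?outer_measure0 ?ltry//.
rewrite ballEmdist; apply/seteqP; split => // y /=.
by move/lt_le_trans => /(_ _ r0); rewrite ltNge mdist_ge0.
Qed.

Lemma bounded_ltoo x r (A : set X) : A `<=` ball x r -> (mu A < +oo)%E.
Proof. by move=> Ar; apply: le_lt_trans (ball_ltoo x r); exact: le_outer_measure. Qed.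

Lemma doubling_iter : exists2 cd : R, 0 < cd & forall x r k, 0 < r ->
  (mu (ball x (2 ^+ k * r)) <= (cd ^+ k)%:E * mu (ball x r))%E.
Proof.
case: mu_doubling => cd cd0 H; exists cd => // x r k r0.
elim: k => [|k IH]; first by rewrite !expr0 mul1r mul1e.
have [|_ + _] := H x (2 ^+ k * r); first by rewrite mulr_gt0// exprn_gt0.
rewrite mulrA -exprS => /le_trans; apply.
by rewrite exprS EFinM -muleA lee_pmul2l// lte_fin.
Qed.

(** Packing argument: the balls of radius [e / 2] around [e]-separated points of
    [ball x0 r] are disjoint, lie in a fixed ball and have measure bounded below
    by iterated doubling, so their number is bounded. *)
Lemma doubling_totally_bounded x0 r e : 0 < r -> 0 < e ->
  exists s : seq X, forall y, ball x0 r y -> exists2 x, x \in s & mdist x y < e.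
Proof.
move=> r0 e0; apply: contrapT => nos.
have e20 : 0 < e / 2 by rewrite divr_gt0.
have [cd cd0 Hcd] := doubling_iter.
have [k kP] : exists k, 2 * r < 2 ^+ k * (e / 2).
  exists (Num.truncn (2 * r / (e / 2))).+1; rewrite -ltr_pdivrMr//.
  apply: lt_le_trans (Num.Theory.truncnS_gt _) _.
  by rewrite -natrX ler_nat ltnW// ltn_expl.
pose V := fine (mu (ball x0 r)).
have VE : mu (ball x0 r) = V%:E.
  by rewrite /V fineK// ge0_fin_numE ?outer_measure_ge0// ball_ltoo.
have V0 : 0 < V by rewrite -lte_fin -VE ball_gt0.
pose m := V / cd ^+ k.
have m0 : 0 < m by rewrite divr_gt0// exprn_gt0.
have mP x : ball x0 r x -> (m%:E <= mu (ball x (e / 2)))%E.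
  move=> x0x; have B0 := ball_ltoo x (e / 2).
  have : (mu (ball x0 r) <= (cd ^+ k)%:E * mu (ball x (e / 2)))%E.
    apply: le_trans (Hcd x _ k e20); apply: le_outer_measure => y x0y.
    move: x0x x0y; rewrite !ballEmdist /= => x0x x0y.
    have := metric_triangle x x0 y; rewrite (metric_sym x x0); lra.
  move: B0; rewrite VE; have : (0 <= mu (ball x (e / 2)))%E by exact: outer_measure_ge0.
  case: (mu (ball x (e / 2))) => [b||] //= _ _; rewrite -EFinM !lee_fin.
  by rewrite ler_pdivrMr ?exprn_gt0// mulrC.
pose A (s : seq X) := [set y | exists2 x, x \in s & mdist x y < e / 2].
have mA s : @measurable _ Y (A s).
  apply: open_cara; rewrite (_ : A s = \bigcup_(x in [set` s]) ball x (e / 2)).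
    by apply: bigcup_open => x _; exact: open_ball.
  apply/seteqP; split => y [x xs xy]; exists x => //; first by rewrite ballEmdist.
  by rewrite ballEmdist in xy.
have [C CE] : exists C : R, mu (ball x0 (r + e / 2)) = C%:E.
  exists (fine (mu (ball x0 (r + e / 2)))).
  by rewrite fineK// ge0_fin_numE ?outer_measure_ge0// ball_ltoo.
have packing n : exists2 s : seq X, (forall x, x \in s -> ball x0 r x) &
    ((n%:R * m)%:E <= mu (A s))%E.
  elim: n => [|n [s sr sn]].
    by exists [::] => //; rewrite mul0r outer_measure_ge0.
  have [x x0x xs] : exists2 x, ball x0 r x & forall x', x' \in s -> e <= mdist x' x.
    apply: contrapT => H; apply: nos; exists s => y x0y.
    apply: contrapT => H'; apply: H; exists y => // x' x's.
    by rewrite leNgt; apply/negP => x'y; apply: H'; exists x'.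
  exists (x :: s); first by move=> x'; rewrite in_cons => /predU1P[->//|/sr].
  have -> : A (x :: s) = ball x (e / 2) `|` A s.
    rewrite ballEmdist; apply/seteqP; split => y.
      by case=> x' /[!in_cons] /predU1P[->|x's] x'y; [left|right; exists x'].
    case=> [xy|[x' x's x'y]]; first by exists x => //; rewrite mem_head.
    by exists x' => //; rewrite in_cons x's orbT.
  have := @measureU _ _ _ nu _ _ (open_cara (open_ball x (e / 2))) (mA s).
  move=> /= ->; last first.
    rewrite ballEmdist; apply/seteqP; split => // y [/= xy [x' x's x'y]].
    have := metric_triangle x' y x; have := xs _ x's; rewrite (metric_sym y x); lra.
  rewrite -natr1 mulrDl mul1r EFinD addeC; apply: leeD => //; exact: mP.
have [s sr] := packing (Num.truncn (C / m)).+1.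
apply/negP; rewrite -ltNge; apply: (@le_lt_trans _ _ C%:E).
  rewrite -CE; apply: le_outer_measure => y [x /sr].
  rewrite !ballEmdist /= => x0x xy.
  have := metric_triangle x0 x y; lra.
by rewrite lte_fin -ltr_pdivrMr// Num.Theory.truncnS_gt.
Qed.

Lemma doubling_proper x r : compact [set y | mdist x y <= r].
Proof.
apply: totally_bounded_compact; first exact: closed_cball.
move=> e e0; have r0 : 0 < `|r| + 1 by rewrite ltr_wpDl.
have [s sP] := doubling_totally_bounded x r0 e0; exists s => y /= xy.
by apply: sP; rewrite ballEmdist /=; have := ler_norm r; lra.
Qed.

(** Borel regularity gives a Borel hull of the same measure, which differs by a
    null set if this measure is finite; hence the decomposition into bounded
    pieces. *)
Lemma borel_hull (A : set X) : @measurable _ Y A ->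
  exists H, [/\ <<s @open X >> H, A `<=` H & nu (H `\` A) = 0%E].
Proof.
move=> mA; pose An n := A `&` ball (point : X) n.+1%:R.
have mAn n : @measurable _ Y (An n).
  by apply: measurableI => //; exact/open_cara/open_ball.
have Anoo n : (mu (An n) < +oo)%E.
  by apply: (@bounded_ltoo point n.+1%:R) => x [].
case: mu_regular => _ reg.
have [H HP] := choice (fun n => reg (An n)).
exists (\bigcup_n H n); split.
- by apply: sigma_algebra_bigcup => n; case: (HP n).
- move=> x Ax; exists (Num.truncn (mdist point x)) => //.
  case: (HP (Num.truncn (mdist (point : X) x))) => _ + _; apply; split => //.
  by rewrite ballEmdist /=; exact: Num.Theory.truncnS_gt.
apply/negligibleP.
  apply: measurableD => //; apply: bigcup_measurable => n _.
  by apply: borel_cara; case: (HP n).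
apply: (@negligibleS _ _ _ nu (\bigcup_n (H n `\` An n))).

  move=> x [[n _ Hx] nA]; exists n => //; split => // -[] //.
apply: negligible_bigcup => n; have [bH AH HA] := HP n.
have mH := borel_cara bH.
apply/negligibleP; first exact: measurableD.
rewrite measureD//; last by rewrite /= HA.
by rewrite setIidr//= HA subee// ge0_fin_numE ?outer_measure_ge0.
Qed.

End measure_theory.

(** * Truncation and total variation *)

Section truncation.
Context {R : realType}.
Implicit Types a b : \bar R.
Local Open Scope ereal_scope.

(** Minus the excess of [a] over [M] is the variation tested against the
    minimizer; [cut_above] is written as a sum of extended reals so that
    [cut_above M \o u] is literally [u] plus this variation. *)
Definition neg_excess (M : R) a : \bar R := - maxe (a - M%:E) 0.
Definition cut_above (M : R) a : \bar R := a + neg_excess M a.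

Lemma neg_excess_EFin M (r : R) :
  neg_excess M r%:E = (M - Num.max r M)%:E.
Proof.
rewrite /neg_excess -EFinB -EFin_max -EFinN; congr EFin.
by case: (leP r M) => rM; case: (leP (r - M)%R 0%R) => ?; lra.
Qed.

Lemma cut_above_EFin M (r : R) : cut_above M r%:E = (Num.min r M)%:E.
Proof.
rewrite /cut_above neg_excess_EFin -EFinD; congr EFin.
by case: (leP r M) => rM; lra.
Qed.

Lemma measurable_neg_excess M : measurable_fun [set: \bar R] (neg_excess M).
Proof.
apply: measurableT_comp; first exact: oppe_measurable.
by apply: measurable_maxe => //; apply: emeasurable_funB.
Qed.

Lemma measurable_cut_above M : measurable_fun [set: \bar R] (cut_above M).
Proof. by apply: emeasurable_funD => //; exact: measurable_neg_excess. Qed.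

Lemma neg_excess_contract M a b : a \is a fin_num ->
  `|neg_excess M a - neg_excess M b| <= `|a - b|.
Proof.
case: a => [a||] // _; case: b => [b||]; rewrite ?leey//.
rewrite !neg_excess_EFin -!EFinB !abse_EFin lee_fin.
rewrite ler_norml; apply/andP; split; have := ler_norm (a - b)%R;
  have := ler_norm (b - a)%R; rewrite (distrC b a);
  case: (leP a M) => ?; case: (leP b M) => ?; lra.
Qed.

Lemma cut_above_contract M a b : a \is a fin_num ->
  `|cut_above M a - cut_above M b| <= `|a - b|.
Proof.
case: a => [a||] // _; case: b => [b||]; rewrite ?leey//.
rewrite !cut_above_EFin -!EFinB !abse_EFin lee_fin.
rewrite ler_norml; apply/andP; split; have := ler_norm (a - b)%R;
  have := ler_norm (b - a)%R; rewrite (distrC b a);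
  case: (leP a M) => ?; case: (leP b M) => ?; lra.
Qed.

Lemma neg_excess_fin M a : a \is a fin_num -> neg_excess M a \is a fin_num.
Proof. by case: a => // r _; rewrite neg_excess_EFin. Qed.

Lemma cut_above_fin M a : a \is a fin_num -> cut_above M a \is a fin_num.
Proof. by case: a => // r _; rewrite cut_above_EFin. Qed.

End truncation.

Lemma limn_einf_le_split (R : realType) (a b x : nat -> \bar R) (c : R) :
  0 < c -> (forall i, 0 <= a i)%E -> (forall i, 0 <= b i)%E ->
  (forall i, a i + b i <= c%:E * x i)%E ->
  (limn_einf a + limn_einf b <= c%:E * limn_einf x)%E.
Proof.
move=> c0 a0 b0 abx.
have einfs_ge0 (u : nat -> \bar R) : (forall i, 0 <= u i)%E ->
    forall n, (0 <= einfs u n)%E.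
  by move=> u0 n; apply: le_ereal_inf_tmp => _ [k _ <-].
have E (u : nat -> \bar R) : limn_einf u = ereal_sup (range (einfs u)).
  by rewrite limn_einf_lim; apply/cvg_lim => //; exact: cvg_einfs_sup.
have le_sup (u : nat -> \bar R) n : (einfs u n <= limn_einf u)%E.
  by rewrite E; apply: ereal_sup_ubound; exists n.
have cva : einfs a n @[n --> \oo] --> limn_einf a by rewrite E; exact: cvg_einfs_sup.
have cvb : einfs b n @[n --> \oo] --> limn_einf b by rewrite E; exact: cvg_einfs_sup.
have def : (limn_einf a +? limn_einf b)%E.
  apply: ge0_adde_def; rewrite inE.
    exact: le_trans (einfs_ge0 _ a0 0%N) (le_sup a 0%N).
  exact: le_trans (einfs_ge0 _ b0 0%N) (le_sup b 0%N).
have cvab : (einfs a n + einfs b n)%E @[n --> \oo] --> (limn_einf a + limn_einf b)%E.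
  exact: cvgeD.
rewrite -(cvg_lim _ cvab)//; apply: lime_le; first by apply/cvg_ex; eexists; exact: cvab.
apply: nearW => n; rewrite muleC -lee_pdivrMr// muleC.
apply: le_trans (le_sup x n); apply: le_ereal_inf_tmp => _ [k /= nk <-].
rewrite muleC lee_pdivrMr// muleC; apply: le_trans (abx k).
by apply: leeD; apply: ereal_inf_lbound; exists k.
Qed.

Lemma limn_einf_lt_frequently (R : realType) (x : nat -> \bar R) (c : \bar R) N :
  (limn_einf x < c)%E -> exists2 i, (N <= i)%N & (x i < c)%E.
Proof.
rewrite limn_einf_lim => xc.
have : (einfs x N < c)%E.
  apply: le_lt_trans xc; apply: lime_ge; first exact: is_cvg_einfs.
  by near=> n; apply: nondecreasing_einfs; near: n; exists N.
by move=> /ereal_inf_lt [_ [i /= Ni <-] ic]; exists i.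
Unshelve. all: by end_near. Qed.

Lemma adde_le_absorb (R : realType) (a b t : \bar R) :
  (0 <= a -> 0 <= b -> a + b <= t -> t <= a -> t < +oo -> b <= 0)%E.
Proof.
case: t => [t||]; case: a => [a||]; case: b => [b||] //=.
by rewrite -EFinD !lee_fin; lra.
Qed.

Section total_variation.
Context {R : realType} {X : completeMetricType R}.
Variable mu : {outer_measure set X -> \bar R}.
Hypotheses (mu_regular : borel_regular mu) (mu_doubling : doubling mu).
Local Notation Y := (caratheodory_type mu).
Local Notation nu := (cara_measure mu).
Implicit Types (U V Om : set X) (u v g : X -> \bar R).

Lemma compact_ltoo (K : set X) : compact K -> (mu K < +oo)%E.
Proof.
move=> cK; have [[x0 Kx0]|nK] := pselect (K !=set0); last first.
  rewrite (_ : K = set0) ?outer_measure0//.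
  by apply/seteqP; split => // x Kx; apply: nK; exists x.
have cf : {within K, continuous (mdist x0)}.
  apply: continuous_subspaceT; apply: (@lipschitz_continuous _ _ _ 1) => // y z.
  by rewrite mul1r mdist_lipschitz.
have [z _ zP] := compact_EVT_max (ex_intro _ _ Kx0) cK cf.
apply: (@bounded_ltoo _ _ mu mu_doubling x0 (mdist x0 z + 1)) => y Ky.
rewrite ballEmdist /=; apply: (@le_lt_trans _ _ (mdist x0 z)); last by rewrite ltrDl.
by apply: zP; rewrite inE.
Qed.

Lemma compactly_inside_ltoo V U : compactly_inside V U -> (mu V < +oo)%E.
Proof.
move=> [_ cV _]; apply: le_lt_trans (compact_ltoo cV).
by apply: le_outer_measure; exact: subset_closure.
Qed.

(** Remove from a ball the closure of the [1 / (n + 1)]-neighbourhood of the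
    complement of [U]: the closure of what remains still avoids the
    neighbourhood itself, hence lies in [U]. *)
Lemma open_exhaustion U : open U -> exists V : nat -> set X,
  (forall n, compactly_inside (V n) U) /\ \bigcup_n V n = U.
Proof.
move=> oU; pose N n := \bigcup_(y in ~` U) ball y n.+1%:R^-1.
have oN n : open (N n) by apply: bigcup_open => y _; exact: open_ball.
have n0 n : 0 < n.+1%:R^-1 :> R by rewrite invr_gt0.
have oV n : open (ball (point : X) n.+1%:R `&` ~` closure (N n)).
  apply: openI; first exact: open_ball.
  by apply: closed_openC; exact: closed_closure.
exists (fun n => ball (point : X) n.+1%:R `&` ~` closure (N n)); split.
  move=> n; set V := _ `&` _.
  have clV : closure V `<=` [set y | mdist point y <= n.+1%:R] `&` ~` N n.
    have cl : closed ([set y | mdist point y <= n.+1%:R] `&` ~` N n).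
      by apply: closedI; [exact: closed_cball|exact: open_closedC].
    rewrite [X in _ `<=` X](closure_id _).1//; apply: closureS => y [].
    rewrite ballEmdist /= => /ltW py nN; split => //.
    by move=> Ny; apply: nN; exact: subset_closure.
  split; first exact: oV.
    apply: (@subclosed_compact _ _ [set y | mdist (point : X) y <= n.+1%:R]).
    - exact: closed_closure.
    - exact: (doubling_proper mu_regular mu_doubling).
    - by move=> y /clV[].
  move=> y /clV[_ nN]; apply: contrapT => nU; apply: nN; exists y => //.
  exact: ballxx.
apply/seteqP; split => x.
  move=> [n _ [_ nN]]; apply: contrapT => nU; apply: nN; apply: subset_closure.
  by exists x => //; exact: ballxx.
move=> Ux; have /nbhs_ballP [r /= r0 rU] : nbhs x U by exact: open_nbhs_nbhs.
pose n := maxn (Num.truncn (mdist point x)) (Num.truncn (2 / r)).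
have pn : mdist point x < n.+1%:R.
  apply: lt_le_trans (Num.Theory.truncnS_gt _) _.
  by rewrite ler_nat ltnS leq_maxl.
have rn : 2 * n.+1%:R^-1 < r.
  rewrite ltr_pdivrMr// mulrC -ltr_pdivrMr//.
  apply: lt_le_trans (Num.Theory.truncnS_gt _) _.
  by rewrite ler_nat ltnS leq_maxr.
exists n => //; split; first by rewrite ballEmdist.
move=> /(_ _ (nbhsx_ballx x _ (n0 n))) [z [[y nUy]]].
rewrite !ballEmdist /= => yz xz; apply: nUy; apply: rU.
rewrite ballEmdist /=; have := metric_triangle x z y.
rewrite (metric_sym z y); move: rn yz xz; move: (n.+1%:R^-1) => q; lra.
Qed.

Lemma N11loc_measurable U v : open U -> N11loc mu U v ->
  @measurable_fun _ _ Y _ U v.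
Proof.
move=> oU vN; have [V [Vi VU]] := open_exhaustion oU.
rewrite -VU; apply/measurable_fun_bigcup.
  by move=> n; apply: (open_cara mu_regular); case: (Vi n).
by move=> n; case: (vN _ (Vi n)).
Qed.

Lemma upper_gradient_integral_ge0 V v g : upper_gradient V v g ->
  (0 <= \int[nu]_(x in V) g x)%E.
Proof. by move=> [_ g0 _]; apply: integral_ge0 => x; exact: g0. Qed.

Lemma N11_ltoo V u : N11 mu V u -> (\int[nu]_(x in V) `|u x| < +oo)%E.
Proof.
move=> [_]; apply: le_lt_trans; rewrite leeDl//.
by apply: le_ereal_inf_tmp => _ [g ug <-]; exact: upper_gradient_integral_ge0 ug.
Qed.

Lemma N11_contract V v (phi : \bar R -> \bar R) : open V -> (mu V < +oo)%E ->
  measurable_fun setT phi ->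
  (forall a, a \is a fin_num -> phi a \is a fin_num) ->
  (forall a b, a \is a fin_num -> b \is a fin_num ->
    `|phi a - phi b| <= `|a - b|)%E ->
  N11 mu V v -> N11 mu V (phi \o v).
Proof.
move=> oV Voo mphi phif phi1 vN.
have mV := open_cara mu_regular oV.
have [mv vfin] := vN.
have [_ [g vg <-] goo] : exists2 y,
    [set (\int[nu]_(x in V) g x)%E | g in upper_gradient V v] y & (y < +oo)%E.
  apply: ereal_inf_lt; apply: le_lt_trans vfin.
  by rewrite leeDr// integral_ge0.
have phig := upper_gradient_contract oV phif phi1 vg.
split; first exact: measurableT_comp.
apply: lte_add_pinfty.
  apply: (@le_lt_trans _ _ (\int[nu]_(x in V) (`|v x| + `|phi 0%E|))%E).
    apply: ge0_le_integral => //.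
    - by apply: measurableT_comp => //; exact: measurableT_comp.
    - by apply: emeasurable_funD => //; exact: measurableT_comp.
    move=> x Vx; have vx := upper_gradient_fin vg Vx.
    have phi0 := phif 0%E isT; have phix := phif _ vx.
    have := phi1 _ 0%E vx isT; rewrite sube0 /=.
    move: phi0 phix; case: (phi 0%E) => [p||] //; case: (phi (v x)) => [q||] // _ _.
    move: vx; case: (v x) => [r||] // _; rewrite -EFinB !abse_EFin -EFinD !lee_fin.
    by move=> H; have := ler_normD (q - p) p; rewrite subrK => /le_trans; apply; lra.
  rewrite ge0_integralD//; last exact: measurableT_comp.
  apply: lte_add_pinfty; first exact: N11_ltoo.
  rewrite integral_cst//=; apply: lte_mul_pinfty => //.
  by rewrite abse_fin_num; exact: phif.
by apply: le_lt_trans goo; apply: ereal_inf_lbound; exists g.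
Qed.

Lemma cvg_L1loc_contract U (v : nat -> X -> \bar R) u (phi : \bar R -> \bar R) :
  (forall i, N11loc mu U (v i)) -> (forall i x, U x -> v i x \is a fin_num) ->
  @measurable_fun _ _ Y _ setT u -> measurable_fun setT phi ->
  (forall a b, a \is a fin_num -> `|phi a - phi b| <= `|a - b|)%E ->
  cvg_L1loc mu U v u -> cvg_L1loc mu U (fun i => phi \o v i) (phi \o u).
Proof.
move=> vN vf mu_ mphi phi1 vu V VU; have [oV _ cVU] := VU.
have mV := open_cara mu_regular oV.
have muV : @measurable_fun _ _ Y _ V u by exact: measurable_funS mu_.
have mvV i : @measurable_fun _ _ Y _ V (v i) by case: (vN i V VU).
apply: (squeeze_cvge _ (cvg_cst _) (vu V VU)); apply: nearW => i.
rewrite integral_ge0//=; apply: ge0_le_integral => //.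
- apply: measurableT_comp => //; apply: emeasurable_funB; exact: measurableT_comp.
- by apply: measurableT_comp => //; exact: emeasurable_funB.
- by move=> x Vx; apply: phi1; apply: vf; apply: cVU; exact: subset_closure.
Qed.

Lemma total_variation_ge0 U u : (0 <= total_variation_open mu U u)%E.
Proof.
apply: le_ereal_inf_tmp => _ [v [g [_ vg _ ->]]].
rewrite limn_einf_lim; apply: lime_ge; first exact: is_cvg_einfs.
apply: nearW => n; apply: le_ereal_inf_tmp => _ [k _ <-].
exact: upper_gradient_integral_ge0 (vg k).
Qed.

Lemma upper_gradient_neg_excess U v g (M e : R) H : open U -> 0 < e ->
  <<s @open X >> H -> (forall x, U x -> M%:E < v x -> H x)%E ->
  upper_gradient U v g ->
  upper_gradient U (neg_excess M \o v) (fun x => (\1_H x + e)%:E * g x)%E.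
Proof.
move=> oU e0 bH vH vg; have vf x := upper_gradient_fin vg (x := x).
have := upper_gradient_max oU e0 bH vH vg.
move=> /(@upper_gradient_contract _ _ _ _ _ (fun a => M%:E - a)%E) H1.
apply: (upper_gradient_eq _ (H1 oU _ _)) => [x /vf|a|a b].
- by rewrite /=; case: (v x) => // r _; rewrite neg_excess_EFin -EFin_max.
- by rewrite fin_numB.
- case: a => // a; case: b => // b _ _.
  rewrite -!EFinB !abse_EFin lee_fin distrC.
  by rewrite (_ : _ - _ = a - b)//; lra.
Qed.

Lemma upper_gradient_cut_above U v g (M e : R) H : open U -> 0 < e ->
  <<s @open X >> H -> (forall x, U x -> v x < M%:E -> H x)%E ->
  upper_gradient U v g ->
  upper_gradient U (cut_above M \o v) (fun x => (\1_H x + e)%:E * g x)%E.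
Proof.
move=> oU e0 bH vH vg; have vf x := upper_gradient_fin vg (x := x).
have oppf (a : \bar R) : a \is a fin_num -> (- a)%E \is a fin_num by rewrite fin_numN.
have opp1 (a b : \bar R) : a \is a fin_num -> b \is a fin_num -> (`|- a - - b| <= `|a - b|)%E.
  case: a => // a; case: b => // b _ _.
  suff : `|- a - - b| <= `|a - b| by rewrite -lee_fin.
  by rewrite -opprD normrN.
have Nvg := upper_gradient_contract oU oppf opp1 vg.
have NvH x : U x -> ((- M)%:E < (-%E \o v) x)%E -> H x.
  by move=> Ux; rewrite /= EFinN lteN2; exact: vH.
have := upper_gradient_contract oU oppf opp1 (upper_gradient_max oU e0 bH NvH Nvg).
apply: upper_gradient_eq => x /vf /=; case: (v x) => // r _.
rewrite cut_above_EFin -EFinN -EFin_max -EFinN; congr EFin.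
by case: (leP r M) => ?; case: (leP (- r) (- M)) => ?; lra.
Qed.

(** Let [v] approximate [u].  The Borel hulls of [{v > M}] and [{v < M}] overlap
    in a null set only, so that the upper gradients obtained by locality for the
    two truncations of [v] have integrals adding up to at most [1 + 2 * e] times
    that of [g]. *)
Lemma total_variation_truncation U u (M : R) : open U ->
  @measurable_fun _ _ Y _ setT u ->
  (total_variation_open mu U (cut_above M \o u) +
   total_variation_open mu U (neg_excess M \o u) <=
   total_variation_open mu U u)%E.
Proof.
move=> oU mu_; apply: le_ereal_inf_tmp => _ [v [g [vN vg vu ->]]].
have mU := open_cara mu_regular oU.
have vf i x : U x -> v i x \is a fin_num by exact: upper_gradient_fin (vg i).
set l := limn_einf _.
have [loo|] := ltP l +oo%E; last by rewrite leye_eq => /eqP ->; rewrite leey.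
have l0 : (0 <= l)%E.
  rewrite /l limn_einf_lim; apply: lime_ge; first exact: is_cvg_einfs.
  apply: nearW => n; apply: le_ereal_inf_tmp => _ [k _ <-].
  exact: upper_gradient_integral_ge0 (vg k).
suff H e : 0 < e -> (total_variation_open mu U (cut_above M \o u) +
   total_variation_open mu U (neg_excess M \o u) <= (1 + 2 * e)%:E * l)%E.
  have lf : l \is a fin_num by rewrite ge0_fin_numE.
  apply/lee_addgt0Pr => e e0.
  have l1 : 0 < 2 * (fine l + 1) by rewrite mulr_gt0// ltr_wpDl ?fine_ge0.
  apply: le_trans (H (e / (2 * (fine l + 1))) _) _; first by rewrite divr_gt0.
  rewrite -(fineK lf) -EFinM -EFinD lee_fin mulrDl mul1r lerD2l.
  rewrite (_ : 2 * (e / (2 * (fine l + 1))) * fine l = e * (fine l / (fine l + 1))); last first.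
    by field; rewrite gt_eqF// ltr_wpDl ?fine_ge0.
  apply: ler_piMr; first exact: ltW.
  by rewrite ler_pdivrMr ?mul1r ?lerDl// ltr_wpDl ?fine_ge0.
move=> e0.
have mgi i : @measurable_fun _ _ Y _ U (g i).
  by apply: borel_fun_cara => //; case: (vg i).
have gi0 i x : U x -> (0 <= g i x)%E by case: (vg i) => _ + _; apply.
have mvi i : @measurable_fun _ _ Y _ U (v i) by exact: N11loc_measurable.
have hull_above i := borel_hull mu_regular mu_doubling
  (emeasurable_fun_o_infty mU (mvi i) M%:E).
have hull_below i := borel_hull mu_regular mu_doubling
  (emeasurable_fun_infty_o mU (mvi i) M%:E).
have [H HP] := choice hull_above.
have [H' H'P] := choice hull_below.
pose k i x := ((\1_(H i) x + e)%:E * g i x)%E.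
pose k' i x := ((\1_(H' i) x + e)%:E * g i x)%E.
have vk i : upper_gradient U (neg_excess M \o v i) (k i).
  have [bH AH _] := HP i.
  by apply: upper_gradient_neg_excess (vg i) => // x Ux Mx; apply: AH.
have vk' i : upper_gradient U (cut_above M \o v i) (k' i).
  have [bH AH _] := H'P i.
  by apply: upper_gradient_cut_above (vg i) => // x Ux Mx; apply: AH.
have [mneg mcut] := (measurable_neg_excess M, measurable_cut_above M).
apply: (@le_trans _ _ (limn_einf (fun i => \int[nu]_(x in U) k' i x) +
                       limn_einf (fun i => \int[nu]_(x in U) k i x))%E).
  apply: leeD; apply: ereal_inf_lbound.
    exists (fun i => cut_above M \o v i), k'; split => //.
    - move=> i V VU; have [oV _ _] := VU.
      apply: N11_contract (vN i V VU) => //.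
      + exact: compactly_inside_ltoo VU.
      + by move=> a; exact: cut_above_fin.
      + by move=> a b af _; exact: cut_above_contract.
    - by apply: cvg_L1loc_contract => // a b; exact: cut_above_contract.
  exists (fun i => neg_excess M \o v i), k; split => //.
  - move=> i V VU; have [oV _ _] := VU.
    apply: N11_contract (vN i V VU) => //.
    + exact: compactly_inside_ltoo VU.
    + by move=> a; exact: neg_excess_fin.
    + by move=> a b af _; exact: neg_excess_contract.
  - by apply: cvg_L1loc_contract => // a b; exact: neg_excess_contract.
apply: limn_einf_le_split; first by rewrite addr_gt0// mulr_gt0.
- by move=> i; exact: upper_gradient_integral_ge0 (vk' i).
- by move=> i; exact: upper_gradient_integral_ge0 (vk i).
move=> i; have [bk k0 _] := vk i; have [bk' k'0 _] := vk' i.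
have mk := borel_fun_cara mu_regular oU bk.
have mk' := borel_fun_cara mu_regular oU bk'.
have e2 : 0 <= 1 + 2 * e by rewrite addr_ge0// mulr_ge0// ltW.
rewrite -ge0_integralD// -ge0_integralZl//; last exact: gi0.
apply: ae_ge0_le_integral => //.
- by move=> x Ux; rewrite adde_ge0 ?k0 ?k'0.
- exact: emeasurable_funD.
- by move=> x Ux; rewrite mule_ge0 ?gi0.
- exact: emeasurable_funM.
have [bH AH H0] := HP i; have [bH' AH' H'0] := H'P i.
have mD : nu.-negligible ((H i `\` (U `&` [set x | M%:E < v i x]%E)) `|`
                          (H' i `\` (U `&` [set x | v i x < M%:E]%E))).
  apply: negligibleU; apply/negligibleP => //; apply: measurableD;
    by [exact: borel_cara|exact: emeasurable_fun_o_infty|exact: emeasurable_fun_infty_o].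
apply: negligibleS mD => x /=; apply: contra_notP => nx Ux.
rewrite /k /k' -ge0_muleDl ?lee_fin ?addr_ge0 ?(ltW e0)//.
rewrite lee_wpmul2r ?gi0// -EFinD lee_fin.
have [xH|xH] := boolP (x \in H i); have [xH'|xH'] := boolP (x \in H' i);
  rewrite !indicE ?(negbTE xH) ?(negbTE xH') ?xH ?xH' /=; try lra.
exfalso; apply: nx; move: xH xH'; rewrite !inE => xH xH'.
have [Mv|vM] := leP M%:E (v i x).
  by right; split => // -[].
by left; split => // -[_]; rewrite ltNge ltW.
Qed.

End total_variation.

(** * Cutoff functions and the Poincaré inequality *)

Section distance_to_a_set.
Context {R : realType} {X : completeMetricType R}.
Variable F : set X.
Hypothesis F0 : F !=set0.

Definition infdist (x : X) : R := inf [set mdist x y | y in F].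

Let has_inf_dist x : has_inf [set mdist x y | y in F].
Proof.
split; first by have [y Fy] := F0; exists (mdist x y), y.
by exists 0 => _ [y _ <-]; rewrite mdist_ge0.
Qed.

Lemma infdist_le x y : F y -> infdist x <= mdist x y.
Proof. by move=> Fy; apply: ge_inf; [exact: (has_inf_dist x).2|exists y]. Qed.

Lemma infdist_ge0 x : 0 <= infdist x.
Proof.
by apply: lb_le_inf; [exact: (has_inf_dist x).1|move=> _ [y _ <-]; exact: mdist_ge0].
Qed.

Lemma infdist_eq0 x : F x -> infdist x = 0.
Proof.
by move=> Fx; apply/eqP; rewrite eq_le infdist_ge0 -(mdistxx x) infdist_le.
Qed.

Lemma infdist_gt0 x : closed F -> ~ F x -> 0 < infdist x.
Proof.
move=> clF nFx; rewrite lt_neqAle infdist_ge0 andbT; apply/eqP => d0; apply: nFx.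
apply: clF => B /nbhs_ballP [e /= e0 eB].
have [_ [y Fy <-]] := inf_adherent e0 (has_inf_dist x).
by rewrite -/(infdist x) -d0 add0r => xy; exists y; split => //; apply: eB; rewrite ballEmdist.
Qed.

Lemma infdist_lipschitz x y : `|infdist x - infdist y| <= mdist x y.
Proof.
suff H x' y' : infdist x' <= mdist x' y' + infdist y'.
  rewrite ler_norml; apply/andP; split.
    by have := H y x; rewrite (metric_sym y x); lra.
  by have := H x y; lra.
rewrite -lerBlDl; apply: lb_le_inf; first exact: (has_inf_dist y').1.
move=> _ [z Fz <-]; rewrite lerBlDl.
exact: le_trans (infdist_le x' Fz) (metric_triangle _ _ _).
Qed.

End distance_to_a_set.

Section poincare.
Context {R : realType} {X : completeMetricType R}.
Variable mu : {outer_measure set X -> \bar R}.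
Hypotheses (mu_regular : borel_regular mu) (mu_doubling : doubling mu).
Hypothesis X_poincare : poincare11 mu.
Local Notation Y := (caratheodory_type mu).
Local Notation nu := (cara_measure mu).
Implicit Types (U V Om : set X) (u v g : X -> \bar R).

(** [D] is [infdist F x / rho + max (0, mdist p x - r)]: the second term makes
    [{D <= 1}] bounded, and [rho] is half the distance to [F] of the part of the
    complement of [U] in a large ball, which is positive by compactness. *)
Lemma cutoff (F U : set X) (p : X) (r : R) : closed F -> F !=set0 -> open U ->
  F `<=` U -> exists (D : X -> R) (K : R),
  [/\ 0 < K, forall x y, `|D x - D y| <= K * mdist x y, forall x, 0 <= D x,
      forall x, F x -> mdist p x < r -> D x = 0 &
      (forall x, D x <= 1 -> U x) /\ compactly_inside [set x | D x < 1] U].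
Proof.
move=> clF F0 oU FU.
have proper x s := @doubling_proper _ _ _ mu_regular mu_doubling x s.
have [rho rho0 rhoP] : exists2 rho, 0 < rho &
    forall x, mdist p x <= r + 1 -> infdist F x <= rho -> U x.
  have cK : compact ([set y | mdist p y <= r + 1] `&` ~` U).
    by apply: compact_closedI; [exact: proper|exact: open_closedC].
  have [K0|K0] := pselect ([set y | mdist p y <= r + 1] `&` ~` U !=set0); last first.
    exists 1 => // x px _; apply: contrapT => nU; apply: K0.
    by exists x.
  have cd : {within [set y | mdist p y <= r + 1] `&` ~` U, continuous (infdist F)}.
    apply: continuous_subspaceT; apply: (@lipschitz_continuous _ _ _ 1) => // y z.
    by rewrite mul1r infdist_lipschitz.
  have [z zK zP] := compact_EVT_min K0 cK cd.
  have dz : 0 < infdist F z.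
    apply: infdist_gt0 => // Fz; move: zK; rewrite inE => -[_]; apply.
    exact: FU.
  exists (infdist F z / 2); first by rewrite divr_gt0.
  move=> x px xd; apply: contrapT => nU.
  have : infdist F z <= infdist F x by apply: zP; rewrite inE.
  lra.
pose D x := infdist F x / rho + Num.max 0 (mdist p x - r).
have K0 : 0 < rho^-1 + 1 by rewrite addr_gt0 ?invr_gt0.
have lipD x y : `|D x - D y| <= (rho^-1 + 1) * mdist x y.
  have -> : D x - D y = (infdist F x - infdist F y) / rho +
      (Num.max 0 (mdist p x - r) - Num.max 0 (mdist p y - r)) by rewrite /D; lra.
  apply: le_trans (ler_normD _ _) _; rewrite [leRHS]mulrDl mul1r; apply: lerD.
    have ri : 0 <= rho^-1 by rewrite invr_ge0 ltW.
    by rewrite normrM (ger0_norm ri) mulrC ler_wpM2l// infdist_lipschitz.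
  apply: le_trans (mdist_lipschitz p x y).
  rewrite ler_norml; apply/andP.
  have := ler_norm (mdist p x - mdist p y); have := ler_norm (mdist p y - mdist p x).
  rewrite (distrC (mdist p y)); move: (`|_|) => n.
  by split; case: (leP 0 (mdist p x - r)) => ?; case: (leP 0 (mdist p y - r)) => ?; lra.
have D0 x : 0 <= D x.
  by rewrite addr_ge0 ?divr_ge0 ?infdist_ge0 ?(ltW rho0)// le_max lexx.
have D1 x : D x <= 1 -> mdist p x <= r + 1 /\ infdist F x <= rho.
  have a0 : 0 <= infdist F x / rho by rewrite divr_ge0 ?infdist_ge0 ?ltW.
  have b0 : 0 <= Num.max 0 (mdist p x - r) by rewrite le_max lexx.
  have b1 : mdist p x - r <= Num.max 0 (mdist p x - r) by rewrite le_max lexx orbT.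
  rewrite /D => H; split; first by lra.
  by rewrite -[leRHS]mul1r -ler_pdivrMr//; lra.
exists D, (rho^-1 + 1); split => //.
  move=> x Fx px; rewrite /D infdist_eq0// mul0r add0r max_l//; lra.
have DU x : D x <= 1 -> U x by move=> /D1[]; exact: rhoP.
split => //.
have clD : closed [set x | D x <= 1] by apply: lipschitz_closed lipD; exact: ltW.
have clsub : closure [set x | D x < 1] `<=` [set x | D x <= 1].
  rewrite [X in _ `<=` X](closure_id _).1//; apply: closureS => x /=.
  exact: ltW.
split; first by apply: lipschitz_open lipD; exact: ltW.
  apply: (@subclosed_compact _ _ [set y | mdist p y <= r + 1]).
  - exact: closed_closure.
  - exact: proper.
  - by move=> x /clsub /D1[].
by move=> x /clsub /DU.
Qed.

(** The mean value [a] of [u] is controlled on [Z], where [v] vanishes: there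
    [|a| <= |u - a| + |u - v|].  The second function is needed since the
    estimate is applied to limits [v] of functions [u] with upper gradients. *)
Lemma poincare_vanishing_on (p : X) (r : R) (Z : set X) : 0 < r ->
  @measurable _ Y Z -> Z `<=` ball p r -> (0 < mu Z)%E ->
  exists2 C : R, 0 <= C & exists2 r', r <= r' & forall u v g,
    @measurable_fun _ _ Y _ setT u -> @measurable_fun _ _ Y _ setT v ->
    (forall x, 0 <= u x <= 1)%E -> (forall x, 0 <= v x <= 1)%E ->
    upper_gradient setT u g -> {ae nu, forall x, Z x -> v x = 0%E} ->
    (\int[nu]_(x in ball p r) v x <=
      C%:E * (\int[nu]_(x in ball p r') g x +
              \int[nu]_(x in ball p r) `|u x - v x|))%E.
Proof.
move=> r0 mZ ZB Z0.
have [cP [lambda [cP0 lambda1 poin]]] := X_poincare.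
set B := ball p r; set B' := ball p (lambda * r).
have mB : @measurable _ Y B by apply: open_cara => //; exact: open_ball.
have mB' : @measurable _ Y B' by apply: open_cara => //; exact: open_ball.
have lr0 : 0 < lambda * r by rewrite mulr_gt0// (lt_le_trans ltr01).
have fine_gt0 (A : set X) : (0 < mu A)%E -> (mu A < +oo)%E ->
    exists2 a : R, 0 < a & mu A = a%:E.
  by case: (mu A) => // a; rewrite lte_fin => a0 _; exists a.
have [b b0 BE] : exists2 a : R, 0 < a & mu B = a%:E.
  by apply: fine_gt0; [exact: (ball_gt0 mu_doubling)|exact: (ball_ltoo mu_doubling)].
have [b' b'0 B'E] : exists2 a : R, 0 < a & mu B' = a%:E.
  by apply: fine_gt0; [exact: (ball_gt0 mu_doubling)|exact: (ball_ltoo mu_doubling)].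
have [z z0 ZE] : exists2 a : R, 0 < a & mu Z = a%:E.
  by apply: fine_gt0 => //; exact: (bounded_ltoo mu_doubling ZB).
pose c := b * (cP * r) / b'.
have c0 : 0 <= c by rewrite divr_ge0 ?mulr_ge0 ?ltW.
have bz : 0 <= b / z by rewrite divr_ge0 ?ltW.
exists ((1 + b / z) * (c + 1)).
  by rewrite mulr_ge0 ?addr_ge0.
exists (lambda * r); first by rewrite ler_peMl// ltW.
move=> u v g mu_ mv u01 v01 ug vZ.
have [mg g0 _] := ug.
have mgY := borel_fun_cara mu_regular openT mg.
have uf x : u x \is a fin_num.
  by have := u01 x; case: (u x) => [s||] //; rewrite andbC.
have vf x : v x \is a fin_num.
  by have := v01 x; case: (v x) => [s||] //; rewrite andbC.
have int_u V : @measurable _ Y V -> (mu V < +oo)%E -> nu.-integrable V u.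
  move=> mV Voo; apply/integrableP; split; first exact: measurable_funS mu_.
  apply: (@le_lt_trans _ _ (\int[nu]_(x in V) cst 1%E x)%E).
    apply: ge0_le_integral => //.
    - by apply: measurableT_comp => //; exact: measurable_funS mu_.
    - by move=> x _; have /andP[? ?] := u01 x; rewrite gee0_abs.
  by rewrite integral_cst// mul1e.
have Luloc : L1loc mu setT u.
  move=> V VT; have [oV _ _] := VT.
  apply: int_u; [exact: open_cara|exact: (compactly_inside_ltoo mu_doubling VT)].
pose a := average mu B u.
have af : a \is a fin_num.
  by rewrite /a /average fin_numM// integrable_fin_num//; apply: int_u; rewrite //= BE ltry.
have := poin p r u g r0 Luloc ug; rewrite -/B -/B' -/a.
set I1 := (\int[nu]_(x in B) `|u x - a|)%E.
set I2 := (\int[nu]_(x in B) `|u x - v x|)%E.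
set J := (\int[nu]_(x in B') g x)%E.
have I10 : (0 <= I1)%E by exact: integral_ge0.
have I20 : (0 <= I2)%E by exact: integral_ge0.
have J0 : (0 <= J)%E by apply: integral_ge0 => x _; exact: g0.
rewrite {1}/average /average -/I1 -/J BE B'E /= => H.
have {H} I1J : (I1 <= c%:E * J)%E.
  have -> : I1 = (b%:E * (b^-1%:E * I1))%E.
    by rewrite muleA -EFinM mulfV ?gt_eqF// mul1e.
  have -> : (c%:E * J = b%:E * ((cP * r)%:E * (b'^-1%:E * J)))%E.
    by rewrite !muleA -!EFinM.
  by apply: lee_wpmul2l => //; rewrite lee_fin (ltW b0).
have mua : @measurable_fun _ _ Y _ setT (fun x => `|u x - a|)%E.
  by apply: measurableT_comp => //; exact: emeasurable_funB.
have muv : @measurable_fun _ _ Y _ setT (fun x => `|u x - v x|)%E.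
  by apply: measurableT_comp => //; exact: emeasurable_funB.
have aZ : (`|a| * z%:E <= I1 + I2)%E.
  rewrite -ZE -[leLHS](@integral_cst _ _ _ nu _ mZ).
  apply: (@le_trans _ _ (\int[nu]_(x in Z) (`|u x - a| + `|u x - v x|))%E).
    apply: ae_ge0_le_integral => //.
    - by move=> x _; exact: abse_ge0.
    - by move=> x _; exact: adde_ge0.
    - by apply: emeasurable_funD; exact: measurable_funTS.
    - have := vZ; apply: (@filterS _ _ (ae_filter_ringOfSetsType nu)) => x /= vx Zx.
      rewrite vx// sube0.
      move: (uf x); rewrite -(fineK af); move: (fine a) => a'.
      case: (u x) => [s||] // _.
      rewrite -EFinB !abse_EFin -EFinD lee_fin.
      have := ler_normD (a' - s) s; rewrite subrK (distrC a'); lra.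
  rewrite ge0_integralD//; try exact: measurable_funTS.
  by apply: leeD; apply: ge0_subset_integral => //; exact: measurable_funTS.
have aB : (`|a| * b%:E <= (b / z)%:E * (I1 + I2))%E.
  have -> : (`|a| * b%:E = (b / z)%:E * (`|a| * z%:E))%E.
    rewrite [RHS]muleC -muleA -EFinM; congr (_ * _%:E)%E.
    by field; rewrite gt_eqF.
  by apply: lee_wpmul2l => //; rewrite ?lee_fin// adde_ge0.
have vB : (\int[nu]_(x in B) v x <= I2 + (I1 + `|a| * b%:E))%E.
  rewrite -BE -[X in (_ + (_ + X))%E](@integral_cst _ _ _ nu _ mB).
  have ca0 x : B x -> (0 <= cst `|a| x)%E by move=> _; exact: abse_ge0.
  rewrite -ge0_integralD//; try exact: measurable_funTS.
  rewrite -ge0_integralD//; try exact: measurable_funTS; last 2 first.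
  - by move=> x Bx; rewrite adde_ge0 ?ca0.
  - by apply: emeasurable_funD => //; exact: measurable_funTS.
  apply: ge0_le_integral => //.
  - by move=> x _; have /andP[] := v01 x.
  - exact: measurable_funTS.
  - apply: emeasurable_funD; first exact: measurable_funTS.
    by apply: emeasurable_funD => //; exact: measurable_funTS.
  - move=> x _ /=; move: (uf x) (vf x); rewrite -(fineK af); move: (fine a) => a'.
    case: (u x) => [s||] //; case: (v x) => [t||] // _ _.
    rewrite -!EFinB !abse_EFin -!EFinD lee_fin.
    have := ler_norm (t - s); have := ler_norm (s - a'); have := ler_norm a'.
    rewrite (distrC t); lra.
apply: le_trans vB _.
apply: (@le_trans _ _ ((1 + b / z)%:E * (I1 + I2))%E).
  rewrite EFinD ge0_muleDl ?lee_fin// mul1e.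
  by rewrite addeA (addeC I2) leeD2l.
rewrite EFinM -muleA; apply: lee_wpmul2l; first by rewrite lee_fin addr_ge0.
rewrite ge0_muleDr//; apply: leeD.
  apply: le_trans I1J _; apply: lee_wpmul2r => //; rewrite lee_fin; lra.
by apply: lee_pemull => //; rewrite lee_fin lerDr.
Qed.

End poincare.

(** * Cutting off and extending by zero *)

Section bump.
Context {R : realType}.
Implicit Types (a b : \bar R) (c : R).

(** The threshold [c] will be [theta + D x] with [D] a cutoff function: the
    result is zero as soon as [D x >= 1], and does not see values of [- a] below
    [theta]. *)
Definition bump c a : \bar R := maxe (mine (- a) 1 - c%:E)%E 0%E.

Lemma bump_EFin c (r : R) : bump c r%:E = (Num.max (Num.min (- r) 1 - c) 0)%:E.
Proof. by rewrite /bump -EFinN -EFin_min -EFinB -EFin_max. Qed.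

Lemma bump_ge0 c a : (0 <= bump c a)%E.
Proof. by rewrite /bump le_max lexx orbT. Qed.

Lemma bump_le1 c a : 0 <= c -> (bump c a <= 1)%E.
Proof.
move=> c0; rewrite /bump ge_max lee01 andbT leeBlDr//.
apply: (@le_trans _ _ 1%E); first by rewrite ge_min lexx orbT.
by rewrite leeDl// lee_fin.
Qed.

Lemma bump_le_abs c a : 0 <= c -> (bump c a <= `|a|)%E.
Proof.
move=> c0; case: a => [r||]; rewrite ?leey//.
rewrite bump_EFin lee_fin ge_max normr_ge0 andbT.
have := ler_norm (- r); rewrite normrN; case: (leP (- r) 1) => ?; lra.
Qed.

Lemma bump0 c : 0 <= c -> bump c 0%E = 0%E.
Proof.
move=> c0; rewrite -[X in bump _ X]/(0%R%:E) bump_EFin; congr EFin.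
by rewrite oppr0 min_l// sub0r max_r// oppr_le0.
Qed.

Lemma bump_gt0 c a : (0 < mine (- a) 1 - c%:E)%E -> c < 1 /\ (c%:E <= `|a|)%E.
Proof.
rewrite sube_gt0 lt_min => /andP[ca]; rewrite lte_fin => c1; split => //.
apply: le_trans (ltW ca) _; rewrite -abseN; exact: lee_abs.
Qed.

Lemma bump_contract c a b : a \is a fin_num ->
  (`|bump c a - bump c b| <= `|a - b|)%E.
Proof.
case: a => [a||] // _; case: b => [b||]; rewrite ?leey//.
rewrite !bump_EFin -!EFinB !abse_EFin lee_fin.
rewrite ler_norml; apply/andP; split;
  have := ler_norm (a - b); have := ler_norm (b - a); rewrite (distrC b a);
  case: (leP (- a) 1) => ?; case: (leP (- b) 1) => ?;
  move: (`|_|) => n ? ?;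
  repeat (case: (leP _ (0 : R)) => ?); lra.
Qed.

Lemma bump_eq0 c a : c < 1 -> bump c a = 0%E -> (- c%:E <= a)%E.
Proof.
move=> c1 /eqP; rewrite eq_le bump_ge0 andbT /bump ge_max lexx andbT.
rewrite leeBlDr// add0e ge_min [(1 <= _)%E]lee_fin [1 <= c]leNgt c1 orbF => ac.
by rewrite -leeN2 oppeK.
Qed.

Lemma measurable_bump d (T : measurableType d) (D : set T) (h : T -> \bar R)
    (c : T -> R) : measurable_fun D h -> measurable_fun D c ->
  measurable_fun D (fun x => bump (c x) (h x)).
Proof.
move=> mh mc; apply: measurable_maxe => //; apply: emeasurable_funB.
  by apply: measurable_mine => //; exact: measurableT_comp.
exact/measurable_EFinP.
Qed.

End bump.

Section core.
Context {R : realType} {X : completeMetricType R}.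
Variable mu : {outer_measure set X -> \bar R}.
Hypotheses (mu_regular : borel_regular mu) (mu_doubling : doubling mu).
Local Notation Y := (caratheodory_type mu).
Local Notation nu := (cara_measure mu).
Implicit Types (U V Om : set X) (u v g : X -> \bar R).

Lemma continuous_cara (V : set X) (D : X -> R) : open V -> continuous D ->
  @measurable_fun _ _ Y _ V D.
Proof.
move=> oV cD; apply: measurable_funTS => mT.
apply: (measurability _ (RGenOpens.measurableE R)) => //.
move=> _ [_ [a [b ->] <-]]; rewrite setTI; apply: (open_cara mu_regular).
by apply: open_comp => [x _|]; [exact: cD|exact: interval_open].
Qed.

(** Locality is applied twice: to [D = max (D, 0)], whose slope is thus paid for
    only on [{D > 0}], and to the difference between the truncated function and
    [theta + D], which is paid for only on [S].  The number [e] collects the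
    errors made by [upper_gradient_max]. *)
Lemma bump_upper_gradient U (k gk : X -> \bar R) (D : X -> R) (K theta e : R) :
  open U -> upper_gradient U k gk -> @measurable_fun _ _ Y _ U k ->
  0 < K -> (forall x y, `|D x - D y| <= K * mdist x y) -> (forall x, 0 <= D x) ->
  (forall x, D x <= 1 -> U x) -> 0 < theta -> 0 < e -> e <= 1 ->
  let S := U `&` [set x | 0 < mine (- k x) 1 - (theta + D x)%:E]%E in
  exists2 G, upper_gradient setT
      ((fun x => bump (theta + D x) (k x)) \_ [set x | D x < 1]) G &
    forall A, open A -> (\int[nu]_(x in A) G x <=
      2%:E * \int[nu]_(x in U) gk x +
      (K%:E * nu (A `&` ([set x | (0 < D x)%R] `&` S)) + (3 * e * K)%:E * nu A))%E.
Proof.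
move=> oU ukg mk K0 lipD D0 DU theta0 e0 e1 S.
have kf x := upper_gradient_fin ukg (x := x).
have mU := open_cara mu_regular oU.
have [mgk gk0 _] := ukg.
have contD := lipschitz_continuous (ltW K0) lipD.
have oP : open [set x | 0 < D x].
  rewrite (_ : [set x | _] = D @^-1` [set y | 0 < y])//.
  by apply: open_comp => // x _; exact: contD.
set P := [set x | 0 < D x] in oP *.
have mD := continuous_cara oU contD.
have mS : @measurable _ Y S.
  apply: emeasurable_fun_o_infty => //; apply: emeasurable_funB.
    by apply: measurable_mine => //; exact: measurableT_comp.
  by apply/measurable_EFinP; exact: measurable_funD.
have [H [bH SH HS0]] := borel_hull mu_regular mu_doubling mS.
have mH := borel_cara mu_regular bH.
have mP := open_cara mu_regular oP.
have bP : <<s @open X >> P by exact: sub_sigma_algebra.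
pose q x := ((\1_P x + e)%:E * K%:E)%E.
have uq : upper_gradient U (fun x => (- (theta + D x))%:E) q.
  have PD x : U x -> (0%:E < (EFin \o D) x)%E -> P x by move=> _; rewrite lte_fin.
  have H1 := upper_gradient_max oU e0 bP PD (upper_gradient_lipschitz U (ltW K0) lipD).
  apply: upper_gradient_eq (upper_gradient_contract (phi := fun a => (- theta)%:E - a)%E oU _ _ H1).
  - move=> x Ux /=; rewrite -EFin_max max_l// -EFinB; congr EFin; lra.
  - by case.
  - case=> [a||] // [b||] // _ _; rewrite -!EFinB !abse_EFin lee_fin distrC.
    by rewrite (_ : _ - _ = a - b)//; lra.
have um : upper_gradient U (fun x => mine (- k x) 1)%E gk.
  apply: (upper_gradient_contract (phi := fun a => mine (- a) 1)%E oU _ _ ukg).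
  - by case=> // r _; rewrite -EFinN -EFin_min.
  - case=> [a||] // [b||] // _ _; rewrite -!EFinN -!EFin_min -!EFinB !abse_EFin lee_fin.
    rewrite ler_norml; apply/andP; split;
    have := ler_norm (a - b); have := ler_norm (b - a); rewrite (distrC b a);
    case: (leP (- a) 1) => ?; case: (leP (- b) 1) => ?; lra.
have us := upper_gradientD oU um uq.
have Hs x : U x -> (0%:E < mine (- k x) 1 + (- (theta + D x))%:E)%E -> H x.
  by move=> Ux Hx; apply: SH; split.
have uw := upper_gradient_max oU e0 bH Hs us.
pose G0 x := ((\1_H x + e)%:E * (gk x + q x))%E.
have {}uw : upper_gradient U (fun x => bump (theta + D x) (k x)) G0 by exact: uw.
exists (G0 \_ U).
  apply: (upper_gradient_zero_extension oU (ltW K0) lipD DU) => //.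
  - by move=> x _; exact: bump_ge0.
  - move=> x Ux D1; apply/eqP; rewrite eq_le bump_ge0 andbT.
    by rewrite leNgt; apply/negP; rewrite /bump lt_max ltxx orbF => /bump_gt0[+ _]; lra.
move=> A oA; have mA := open_cara mu_regular oA.
rewrite -integral_mkcondr.
have mAU : @measurable _ Y (A `&` U) by exact: measurableI.
have [bG0 G00 _] := uw.
have mG0 := borel_fun_cara mu_regular oU bG0.
have mgkY := borel_fun_cara mu_regular oU mgk.
pose T := P `&` S.
have mT : @measurable _ Y T by exact: measurableI.
pose bound x := (2%:E * gk x + (K%:E * (\1_T x)%:E + (3 * e * K)%:E))%E.
apply: (@le_trans _ _ (\int[nu]_(x in A `&` U) bound x)%E).
  apply: ae_ge0_le_integral => //.
  - by move=> x [_ Ux]; exact: G00.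
  - exact: measurable_funS mG0.
  - move=> x [_ Ux]; rewrite adde_ge0 ?mule_ge0 ?gk0// adde_ge0 ?mule_ge0 ?lee_fin ?(ltW K0)//.
      by rewrite !mulr_ge0 ?(ltW e0) ?(ltW K0).
  - apply: emeasurable_funD.
      apply: emeasurable_funM => //; exact: measurable_funS mgkY.
    apply: emeasurable_funD => //; apply: emeasurable_funM => //.
    apply/measurable_EFinP; exact: measurable_indic.
  have : nu.-negligible (H `\` S) by apply/negligibleP => //; exact: measurableD.
  apply: negligibleS => x /=; apply: contra_notP => nx [Ax Ux].
  have HS : H x -> S x by move=> Hx; apply: contrapT => nS; exact: nx.
  rewrite /G0 /bound ge0_muleDr ?gk0//; last first.
    by rewrite /q -EFinM lee_fin mulr_ge0 ?(ltW K0)// addr_ge0 ?(ltW e0).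
  have h1 : \1_H x <= 1 :> R by rewrite indicE; case: (_ \in _).
  have he : \1_H x + e <= 2 by lra.
  have p1 : 0 <= (\1_P x : R) <= 1.
    by rewrite indicE; case: (_ \in _); rewrite ?lexx ?ler01.
  apply: leeD; first by apply: lee_wpmul2r; rewrite ?gk0// lee_fin.
  rewrite /q -!EFinM -EFinD lee_fin mulrA [K * _]mulrC -mulrDl ler_wpM2r ?(ltW K0)//.
  have [Hx|nHx] := pselect (H x).
    have -> : \1_T x = \1_P x :> R.
      by rewrite !indicE /T in_setI (mem_set (HS Hx)) andbT.
    rewrite [\1_H x]indicE mem_set//=; move: p1 => /andP[]; move: (\1_P x) => p p0 p1.
    have : e * p <= e by rewrite ler_piMr// ltW.
    have : e * e <= e by rewrite ler_piMr// ltW.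
    by rewrite mulrDl !mulrDr !mul1r; lra.
  have T0 : 0 <= \1_T x :> R by [].
  rewrite [\1_H x]indicE memNset//= add0r.
  move: p1 => /andP[]; move: (\1_P x) => p p0 p1.
  have : e * p <= e by rewrite ler_piMr// ltW.
  have : e * e <= e by rewrite ler_piMr// ltW.
  by rewrite mulrDr; lra.
have mgkAU : @measurable_fun _ _ Y _ (A `&` U) gk by exact: measurable_funS mgkY.
have e3 : 0 <= 3 * e * K by rewrite !mulr_ge0 ?(ltW e0) ?(ltW K0).
rewrite /bound ge0_integralD//; last 4 first.
- by move=> x [_ Ux]; rewrite mule_ge0 ?gk0.
- exact: emeasurable_funM.
- by move=> x _; rewrite adde_ge0 ?mule_ge0 ?lee_fin ?(ltW K0).
- apply: emeasurable_funD => //; apply: emeasurable_funM => //.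
  by apply/measurable_EFinP; exact: measurable_indic.
rewrite ge0_integralD//; last 2 first.
- by move=> x _; rewrite mule_ge0 ?lee_fin ?(ltW K0).
- apply: emeasurable_funM => //.
  by apply/measurable_EFinP; exact: measurable_indic.
rewrite ge0_integralZl//; last by move=> x [_ Ux]; exact: gk0.
apply: leeD.
  by apply: lee_wpmul2l => //; apply: ge0_subset_integral => // x [].
rewrite ge0_integralZl//; last 2 first.
- by apply/measurable_EFinP; exact: measurable_indic.
- by rewrite lee_fin ltW.
rewrite integral_indic// integral_cst//.
apply: leeD; apply: lee_wpmul2l; rewrite ?lee_fin ?(ltW K0)//.
  by apply: le_outer_measure => x [Tx [Ax _]].
by apply: le_outer_measure => x [].
Qed.

End core.

(** * Functions without variation on the closure of a set *)

Section vanishing.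
Context {R : realType} {X : completeMetricType R}.
Variable mu : {outer_measure set X -> \bar R}.
Hypotheses (mu_regular : borel_regular mu) (mu_doubling : doubling mu).
Hypothesis X_poincare : poincare11 mu.
Local Notation Y := (caratheodory_type mu).
Local Notation nu := (cara_measure mu).

Section local.
Variables (Om : set X) (g : X -> \bar R).
Hypotheses (oOm : open Om) (Om0 : Om !=set0).
Hypothesis mg : @measurable_fun _ _ Y _ setT g.
Hypothesis g_off : {ae nu, forall x, (~` Om) x -> g x = 0%E}.
Hypothesis tv_g : (total_variation_set mu (closure Om) g <= 0)%E.

(** Fix [U] with [|Dg|(U) < del] and an approximant [k] of [g] on [U] whose upper
    gradient has integral less than [del].  By [poincare_vanishing_on], the
    integral is bounded by a multiple of [del] which depends on the ball only:
    the smallness of [k - g] and [e] is chosen after the Lipschitz constant [K]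
    of the cutoff function, which depends on [U] and therefore on [del]. *)
Lemma bump_integral_le0 (p : X) (r theta : R) : 0 < r -> 0 < theta ->
  (0 < mu (ball p r `\` Om))%E ->
  (\int[nu]_(x in ball p r) bump theta (g x) <= 0)%E.
Proof.
move=> r0 theta0 Z0; set F := closure Om.
have clF : closed F by exact: closed_closure.
have F0 : F !=set0 by case: Om0 => x Omx; exists x; exact: subset_closure.
have mB : @measurable _ Y (ball p r) by apply: (open_cara mu_regular); exact: open_ball.
have mOm := open_cara mu_regular oOm.
have mZ : @measurable _ Y (ball p r `\` Om) by exact: measurableD.
have [C C0 [r' rr' CP]] :=
  poincare_vanishing_on mu_regular mu_doubling X_poincare r0 mZ (@subDsetl _ _ _) Z0.
set v := fun x => bump theta (g x).
suff main del : 0 < del -> (\int[nu]_(x in ball p r) v x <= (C * (5 * del))%:E)%E.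
  apply/lee_addgt0Pr => e e0; rewrite add0e.
  have C1 : 0 < 5 * (C + 1) by rewrite mulr_gt0// ltr_wpDl.
  apply: le_trans (main (e / (5 * (C + 1))) _) _; first by rewrite divr_gt0.
  rewrite lee_fin (_ : C * (5 * (e / (5 * (C + 1)))) = e * (C / (C + 1))); last first.
    by field; rewrite gt_eqF// ltr_wpDl.
  apply: ler_piMr; first exact: ltW.
  by rewrite ler_pdivrMr ?mul1r ?lerDl// ltr_wpDl.
move=> del0.
have [_ [U [oU FU] <-] TVU] : exists2 y, [set total_variation_open mu U g |
    U in [set U | open U /\ F `<=` U]] y & (y < del%:E)%E.
  by apply: ereal_inf_lt; apply: le_lt_trans tv_g _; rewrite lte_fin.
have [_ [kk [gg [kN kg kcv ->]]] lim_lt] := ereal_inf_lt TVU.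
have [D [K [K0 lipD D0 DF [DU Oc]]]] :=
  cutoff mu_regular mu_doubling p r' clF F0 oU FU.
set O := [set x | D x < 1] in Oc.
have [oO _ _] := Oc.
have mO := open_cara mu_regular oO.
pose del' := Num.min del (del * theta / K).
have del'0 : 0 < del' by rewrite lt_min del0 divr_gt0// mulr_gt0.
have [N _ NP] : \forall i \near \oo, (\int[nu]_(x in O) `|kk i x - g x| < del'%:E)%E.
  apply: (kcv O Oc [set y | (y < del'%:E)%E]); apply: open_nbhs_nbhs; split.
    exact: open_ereal_lt_ereal.
  by rewrite /= lte_fin.
have [i Ni gi] := limn_einf_lt_frequently N lim_lt.
have {Ni NP}kO := NP i Ni.
set k := kk i in kO *; set gk := gg i in gi *.
have ukg : upper_gradient U k gk by exact: kg.
have mU := open_cara mu_regular oU.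
have mkU := N11loc_measurable mu_regular mu_doubling oU (kN i).
have kf x := upper_gradient_fin ukg (x := x).
have OU x : O x -> U x by move=> Ox; apply: DU; exact: ltW.
have mkO : @measurable_fun _ _ Y _ O k by exact: measurable_funS mkU.
set B' := ball p r'.
have oB' : open B' by exact: open_ball.
have [m m0 mE] : exists2 m : R, 0 <= m & mu B' = m%:E.
  exists (fine (mu B')); first by rewrite fine_ge0// outer_measure_ge0.
  by rewrite fineK// ge0_fin_numE ?outer_measure_ge0//; exact: ball_ltoo.
pose e := Num.min 1 (del / (3 * K * (m + 1))).
have m1 : 0 < m + 1 by rewrite ltr_wpDl.
have e0 : 0 < e by rewrite lt_min ltr01 divr_gt0// !mulr_gt0.
have e1 : e <= 1 by rewrite ge_min lexx.
have em : 3 * e * K * m <= del.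
  have : e <= del / (3 * K * (m + 1)) by rewrite ge_min lexx orbT.
  rewrite ler_pdivlMr ?mulr_gt0// => He; apply: le_trans He.
  have : 0 <= e * (3 * K) by rewrite !mulr_ge0 ?(ltW e0) ?(ltW K0).
  rewrite [in leRHS]mulrA mulrDr mulr1 (_ : 3 * e * K = e * (3 * K)); lra.
have [G uG GP] := bump_upper_gradient mu_regular mu_doubling oU ukg mkU K0 lipD D0 DU
  theta0 e0 e1.
set w := _ \_ O in uG; set S := U `&` _ in GP.
have w01 x : (0 <= w x <= 1)%E.
  rewrite /w patchE; case: ifP => _; last by rewrite lexx lee01.
  by rewrite bump_ge0 bump_le1// addr_ge0 ?(ltW theta0).
have mw : @measurable_fun _ _ Y _ setT w.
  apply/(measurable_restrictT _ mO); apply: measurable_bump => //.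
  apply: measurable_funD => //; apply: continuous_cara => //.
  exact: lipschitz_continuous (ltW K0) lipD.
have v01 x : (0 <= v x <= 1)%E by rewrite bump_ge0 bump_le1// ltW.
have mv : @measurable_fun _ _ Y _ setT v by exact: measurable_bump.
have v_off : {ae nu, forall x, (ball p r `\` Om) x -> v x = 0%E}.
  have := g_off; apply: (@filterS _ _ (ae_filter_ringOfSetsType nu)) => x gx [_ nOx].
  by rewrite /v gx// bump0// ltW.
apply: le_trans (CP w v G mw mv w01 v01 uG v_off) _.
rewrite EFinM; apply: lee_wpmul2l; first by rewrite lee_fin.
have -> : (5 * del)%:E = ((2 * del + (del + del))%:E + del%:E)%E.
  by rewrite -EFinD; congr EFin; lra.
have kg_lt : (\int[nu]_(x in O) `|k x - g x| <= del%:E)%E.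
  by apply: ltW; apply: lt_le_trans kO _; rewrite lee_fin ge_min lexx.
have mkg : @measurable_fun _ _ Y _ O (fun x => k x - g x)%E.
  by apply: emeasurable_funB => //; exact: measurable_funTS.
apply: leeD.
  apply: le_trans (GP _ oB') _; rewrite (EFinD (2 * del)) (EFinM 2 del); apply: leeD.
    by apply: lee_wpmul2l => //; exact: ltW.
  rewrite (EFinD del); apply: leeD; last by rewrite /= mE -EFinM lee_fin.
  (* on the ball, [g] is zero almost everywhere in [{D > 0}], so that [k] is as
     large as [k - g] there *)
  have cheb := le_integral_abse nu mO mkg theta0.
  set T := O `&` _ in cheb.
  have mT : (nu (B' `&` ([set x | (0 < D x)%R] `&` S)) <= nu T)%E.
    have [N0 [mN0 N00 N0P]] := g_off.
    apply: (@le_trans _ _ (nu (T `|` N0))).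
      apply: le_outer_measure => x [B'x [/= Dx [Ux]]] /= /bump_gt0[tD tk].
      have [gx|gx] := pselect ((~` Om) x -> g x = 0%E); [left|right; exact: N0P].
      have nOmx : (~` Om) x.
        move=> Omx; have := DF x (subset_closure Omx).
        move: B'x; rewrite /B' ballEmdist /= => B'x /(_ B'x) D0x.
        by rewrite D0x ltxx in Dx.
      have Ox : O x by rewrite /O /=; have := ltW theta0; lra.
      split => //=; rewrite gx// sube0; apply: le_trans tk.
      by rewrite lee_fin lerDl.
    by apply: le_trans (outer_measureU2 _ _ _) _; rewrite /= N00 adde0.
  apply: (@le_trans _ _ ((K / theta)%:E * (theta%:E * nu T))%E).
    rewrite muleA -EFinM divfK ?gt_eqF//; apply: lee_wpmul2l => //.
    by rewrite lee_fin ltW.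
  apply: (@le_trans _ _ ((K / theta)%:E * del'%:E)%E).
    apply: lee_wpmul2l; first by rewrite lee_fin divr_ge0 ?ltW.
    by apply: le_trans cheb _; exact: ltW.
  rewrite -EFinM lee_fin; apply: (@le_trans _ _ (K / theta * (del * theta / K))).
    by apply: ler_wpM2l; [rewrite divr_ge0 ?ltW|rewrite ge_min lexx orbT].
  by rewrite le_eqVlt; apply/orP; left; apply/eqP; field; rewrite !gt_eqF.
apply: le_trans kg_lt.
apply: (@le_trans _ _ (\int[nu]_(x in ball p r `&` O) `|k x - g x|)%E); last first.
  apply: ge0_subset_integral => //; [exact: measurableI|exact: measurableT_comp].
rewrite integral_mkcondr; apply: ae_ge0_le_integral => //.
- by apply: measurableT_comp => //; apply: measurable_funTS; exact: emeasurable_funB.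
- by move=> x _; rewrite patchE; case: ifP.
- apply: measurable_funTS; apply/(measurable_restrictT _ mO).
  exact: measurableT_comp.
have := g_off; apply: (@filterS _ _ (ae_filter_ringOfSetsType nu)) => x gx Bx.
have B'x : mdist p x < r'.
  by move: Bx; rewrite ballEmdist /= => /lt_le_trans; apply.
rewrite /w /v !patchE; case: ifPn => [/set_mem Ox|/negP nOx].
  have kx := kf _ (OU _ Ox).
  have [Omx|nOmx] := pselect (Om x).
    by rewrite DF ?addr0//; [exact: bump_contract|exact: subset_closure].
  rewrite gx// (bump0 (ltW theta0)) !sube0 gee0_abs ?bump_ge0//.
  by apply: bump_le_abs; rewrite addr_ge0 ?(ltW theta0).
have nOmx : (~` Om) x.
  move=> Omx; apply: nOx; rewrite inE /O /= DF//; exact: subset_closure.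
by rewrite gx// (bump0 (ltW theta0)) sube0 abse0.
Qed.

End local.

End vanishing.

Section conclusion.
Context {R : realType} {X : completeMetricType R}.
Variable mu : {outer_measure set X -> \bar R}.
Hypotheses (mu_regular : borel_regular mu) (mu_doubling : doubling mu).
Hypothesis X_poincare : poincare11 mu.
Local Notation Y := (caratheodory_type mu).
Local Notation nu := (cara_measure mu).

(** All large balls around the base point have a part of positive measure outside
    [Om], and [bump_integral_le0] applies to them with arbitrarily small [theta]. *)
Lemma total_variation_eq0_ge0 (Om : set X) (g : X -> \bar R) :
  open Om -> Om !=set0 -> (0 < mu (~` Om))%E ->
  @measurable_fun _ _ Y _ setT g ->
  {ae nu, forall x, (~` Om) x -> g x = 0%E} ->
  (total_variation_set mu (closure Om) g <= 0)%E ->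
  {ae nu, forall x, (0 <= g x)%E}.
Proof.
move=> oOm Om0 comp0 mg g_off tv_g; have mOm := open_cara mu_regular oOm.
pose B n : set X := ball (point : X) n.+1%:R.
have mB n : @measurable _ Y (B n) by apply: (open_cara mu_regular); exact: open_ball.
have mBO n : @measurable _ Y (B n `\` Om) by exact: measurableD.
have Bcover (x : X) n0 : exists2 n, (n0 <= n)%N & B n x.
  exists (maxn n0 (Num.truncn (mdist (point : X) x))); first exact: leq_maxl.
  rewrite /B ballEmdist /=; apply: lt_le_trans (Num.Theory.truncnS_gt _) _.
  by rewrite ler_nat ltnS leq_maxr.
have [n0 Bn0] : exists n0, (0 < mu (B n0 `\` Om))%E.
  apply: contrapT => nB; move: comp0; rewrite lt_neqAle => /andP[/eqP + _]; apply.
  apply/esym; apply/(@negligibleP _ _ _ nu); first exact: measurableC.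
  apply: (@negligibleS _ _ _ nu (\bigcup_n (B n `\` Om))).
    by move=> x nOx; have [n _ Bx] := Bcover x 0%N; exists n.
  apply: negligible_bigcup => n; apply/negligibleP => //.
  apply/eqP; rewrite eq_le outer_measure_ge0 andbT leNgt; apply/negP => H.
  by apply: nB; exists n.
have step n j : \forall x \ae nu, B (n0 + n)%N x -> (- (j.+2%:R^-1)%:E <= g x)%E.
  have j1 : j.+2%:R^-1 < 1 :> R by rewrite invf_lt1 ?ltr1n.
  have j0 : 0 < j.+2%:R^-1 :> R by rewrite invr_gt0.
  have BZ : (0 < mu (B (n0 + n)%N `\` Om))%E.
    apply: lt_le_trans Bn0 _; apply: le_outer_measure => x [Bx nO]; split => //.
    move: Bx; rewrite /B !ballEmdist /= => /lt_le_trans; apply.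
    by rewrite ler_nat ltnS leq_addr.
  have r0 : 0 < (n0 + n).+1%:R :> R by [].
  have := bump_integral_le0 mu_regular mu_doubling X_poincare oOm Om0 mg g_off tv_g r0 j0 BZ.
  rewrite -/(B (n0 + n)%N) => I0.
  have mb : @measurable_fun _ _ Y _ (B (n0 + n)%N) (fun x => bump j.+2%:R^-1 (g x)).
    by apply: measurable_bump => //; exact: measurable_funTS.
  have /(ae_eq_integral_abs nu (mB _) mb) :
      (\int[nu]_(x in B (n0 + n)%N) `|bump j.+2%:R^-1 (g x)| = 0)%E.
    apply/eqP; rewrite eq_le integral_ge0// andbT; apply: le_trans I0.
    rewrite le_eqVlt; apply/orP; left; apply/eqP; apply: eq_integral => x _.
    by rewrite gee0_abs// bump_ge0.
  apply: (@filterS _ _ (ae_filter_ringOfSetsType nu)) => x /= H Bx.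
  exact: bump_eq0 (H Bx).
have : \forall x \ae nu, forall n j, B (n0 + n)%N x -> (- (j.+2%:R^-1)%:E <= g x)%E.
  by apply/ae_foralln => n; apply/ae_foralln => j; exact: step.
apply: (@filterS _ _ (ae_filter_ringOfSetsType nu)) => x H.
have [n n0n Bx] := Bcover x n0.
have {}H j : (- (j.+2%:R^-1)%:E <= g x)%E.
  by apply: (H (n - n0)%N); rewrite subnKC.
move: H; case: (g x) => [r||] H; [|exact: leey|by have := H 0%N].
rewrite lee_fin leNgt; apply/negP => r0.
have := H (Num.truncn (- r)^-1); rewrite leNgt => /negP; apply.
rewrite -EFinN lte_fin ltrNr -[ltRHS]invrK ltf_pV2 ?posrE ?invr_gt0 ?oppr_gt0//.
apply: lt_le_trans (Num.Theory.truncnS_gt _) _.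
by rewrite ler_nat.
Qed.

End conclusion.

(** * The maximum principle *)

Local Open Scope ereal_scope.

Theorem theorem5p1 (R : realType) (X : completeMetricType R)
  (mu : {outer_measure set X -> \bar R})
  (mu_regular : borel_regular mu) (mu_doubling : doubling mu)
  (X_poincare : poincare11 mu)
  (M : R) (f : X -> \bar R) (f_BV : BV mu setT f)
  (f_le : {ae cara_measure mu, forall x, f x <= M%:E})
  (Omega : set X) (Omega_domain : domain Omega)
  (compl_gt0 : 0 < mu (~` Omega))
  (u : X -> \bar R) (u_sol : least_gradient_solution mu Omega f u) :
  {ae cara_measure mu, forall x, Omega x -> u x <= M%:E}.
Proof.
set nu := cara_measure mu.
have [[u_L1 u_tv] [[uf_L1 _] uf_off] u_min] := u_sol.
have [oOm _] := Omega_domain.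
have [Om0|Om0] := pselect (Omega !=set0); last first.
  by apply: aeW => x Omx; exfalso; apply: Om0; exists x.
have mu_ : measurable_fun setT (u : caratheodory_type mu -> \bar R).
  exact: measurable_int u_L1.
pose g := neg_excess M \o u.
have mg : measurable_fun setT (g : caratheodory_type mu -> \bar R).
  by apply: measurableT_comp => //; exact: measurable_neg_excess.
have tv_truncation U : open U -> total_variation_open mu U (cut_above M \o u) +
    total_variation_open mu U g <= total_variation_open mu U u.
  by move=> oU; exact: total_variation_truncation.
have g_abs x : f x <= M%:E -> `|g x| <= `|u x - f x|.
  rewrite /g /=; case: (u x) => [r||] fM.
  - rewrite neg_excess_EFin abse_EFin; move: fM; case: (f x) => [s||] // fM; last exact: leey.
    rewrite -EFinB abse_EFin lee_fin; move: fM; rewrite lee_fin => fM.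
    have := ler_norm (r - s)%R; have := normr_ge0 (r - s)%R.
    by case: (leP r M) => rM; [rewrite subrr normr0|rewrite ler0_norm ?subr_le0 ?(ltW rM)//; lra].
  - by move: fM; case: (f x) => [s||] //= _; exact: leey.
  - by rewrite /neg_excess max_r ?oppe0 ?abse0 ?abse_ge0//; exact: leNye.
have g_off : {ae nu, forall x, (~` Omega) x -> g x = 0}.
  have := @filterI _ _ (ae_filter_ringOfSetsType nu) _ _ f_le uf_off.
  apply: (@filterS _ _ (ae_filter_ringOfSetsType nu)) => x [fM uf] /uf uf0.
  have := g_abs x fM; rewrite uf0 abse0 => g0.
  by apply/eqP; rewrite -abse_eq0 eq_le g0 abse_ge0.
have g_BV0 : BV0 mu Omega g.
  split; last exact: g_off.
  split.
    apply/integrableP; split; first exact: mg.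
    have /integrableP[muf] := uf_L1; apply: le_lt_trans.
    apply: ae_ge0_le_integral => //; try exact: measurableT_comp.
    by have := f_le; apply: (@filterS _ _ (ae_filter_ringOfSetsType nu)) => x fM _; exact: g_abs.
  apply: le_lt_trans u_tv; apply: le_trans (tv_truncation setT openT).
  by rewrite leeDr// total_variation_ge0.
have tv_split : total_variation_set mu (closure Omega) (cut_above M \o u) +
    total_variation_set mu (closure Omega) g <=
    total_variation_set mu (closure Omega) u.
  apply: le_ereal_inf_tmp => _ [U [oU FU] <-]; apply: le_trans (tv_truncation U oU).
  by apply: leeD; apply: ereal_inf_lbound; exists U.
have tv_fin : total_variation_set mu (closure Omega) u < +oo.
  by apply: le_lt_trans u_tv; apply: ereal_inf_lbound; exists setT => //; split => //; exact: openT.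
have tvs_ge0 v : 0 <= total_variation_set mu (closure Omega) v.
  by apply: le_ereal_inf_tmp => _ [U _ <-]; exact: total_variation_ge0.
have tv_g : total_variation_set mu (closure Omega) g <= 0.
  have le_cut : total_variation_set mu (closure Omega) u <=
      total_variation_set mu (closure Omega) (cut_above M \o u).
    exact: (u_min g g_BV0).
  exact: adde_le_absorb (tvs_ge0 _) (tvs_ge0 _) tv_split le_cut tv_fin.
have := total_variation_eq0_ge0 mu_regular mu_doubling X_poincare oOm Om0 compl_gt0 mg g_off tv_g.
apply: (@filterS _ _ (ae_filter_ringOfSetsType nu)) => x.
rewrite /g /= /neg_excess oppe_ge0 ge_max lexx andbT => H _.
by rewrite -[leRHS]add0e -leeBlDr.
Qed.
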